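(* Let $f:[0,1]^n\to\mathbb{R}_+$ be Lipschitz continuous on $[0,1]^n$, of class $C^2$ on $[0,1]^n\setminus\{0\}$, and such that $f(\mu)=0$ if and only if $\mu=0$. Let $(\mu,W)\in\mathcal{W}\mathcal{F}(n)$, let $K\subset\{1,\dots,n\}$ be such that $(\mu,W)\in M(|K|;K)=\mathring\Delta(n;K)\times\mathcal{F}_{I(K)}$, and write $I=I(K)$. Let $(\alpha,X),(\beta,Y)\in T_\mu\mathring\Delta(n;K)\times T_W\mathcal{F}_I$. For $U\in\mathrm{O}(n)$ with $W=\pi_I(U)$ there exist unique $\widetilde X,\widetilde Y\in U\mathfrak{m}_I$ with $X=T_U\pi_I\cdot\widetilde X$ and $Y=T_U\pi_I\cdot\widetilde Y$; put $B=(b_{ij})=U^T\widetilde X$, $C=(c_{ij})=U^T\widetilde Y\in\mathfrak{m}_I$ and define $$g_{\mu,W}\big((\alpha,X),(\beta,Y)\big)=\sum_{i=1}^n\alpha_i\beta_i+\sum_{1\le i<j\le n}f(\mu_{i\to j})^2\,b_{ij}c_{ij}.$$ Then: (i) $g$ is well-defined (the right-hand side does not depend on the choice of $U\in\mathrm{O}(n)$ with $\pi_I(U)=W$); (ii) $g$ induces a Riemannian metric on each cell $M(r;K)$ in the stratification of $\mathcal{W}\mathcal{F}(n)$; (iii) if $\gamma=(\mu,W):[a,b]\to M(r;K)$ is a piecewise $C^1$ path and $U:[a,b]\to\mathrm{O}(n)$ is a piecewise $C^1$ lift of $W$ (i.e. $\pi_{I(K)}\circ U=W$), then the length $L_g$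 induced by $g$ satisfies $$L_g(\gamma)=\int_a^b\sqrt{g_{\gamma(t)}(\dot\gamma(t),\dot\gamma(t))}\,dt=\int_a^b\sqrt{|\dot\mu(t)|^2+\sum_{1\le i<j\le n}f(\mu_{i\to j}(t))^2\,\big(U(t)^T\dot U(t)\big)_{ij}^2}\;dt.$$
   Context: Fix an integer $n\ge1$; $\mathrm{O}(n)$ is the orthogonal group, $\mathrm{Skew}(n)$ the space of real skew-symmetric $n\times n$ matrices. **Flags.** A type is a tuple $I=(p_1,\dots,p_r)$ of positive integers with $p_1+\dots+p_r=n$. $\mathrm{O}(I)\subset\mathrm{O}(n)$ is the subgroup of block-diagonal matrices $\mathrm{diag}(R_1,\dots,R_r)$, $R_i\in\mathrm{O}(p_i)$. $\mathcal{F}_I=\mathrm{O}(n)/\mathrm{O}(I)$ (quotient by right multiplication) carries the quotient topology and the unique smooth structure making the quotient map $\pi_I:\mathrm{O}(n)\to\mathcal{F}_I$ a smooth submersion. $\mathfrak{m}_I\subset\mathrm{Skew}(n)$ is the space of skew-symmetric matrices whose diagonal blocks (of sizes $p_1,\dots,p_r$) vanish; $T_U\pi_I$ restricts to a linear isomorphism from $U\mathfrak{m}_I$ onto $T_{\pi_I(U)}\mathcal{F}_I$. **Weighted flags.** $\Delta(n)=\{\mu\in[0,1]^n:\sum_i\mu_i=1\}$. For $\mu\in\Delta(n)$ let $k_1<\dots<k_s$ be the indices $i$ with $\mu_i>0$. The type $\tau(\mu)$ is $(k_1,k_2-k_1,\dots,k_s-k_{s-1})$ if $k_s=n$, and $(k_1,k_2-k_1,\dots,k_s-k_{s-1},n-k_s)$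 if $k_s<n$. On $\Delta(n)\times\mathrm{O}(n)$ put $(\alpha,U)\sim(\beta,V)$ iff $\alpha=\beta$ and $\pi_{\tau(\alpha)}(U)=\pi_{\tau(\alpha)}(V)$. $\mathcal{W}\mathcal{F}(n)=(\Delta(n)\times\mathrm{O}(n))/\!\sim$; its elements are written $(\mu,W)$ with $\mu\in\Delta(n)$, $W\in\mathcal{F}_{\tau(\mu)}$. **Cells.** For a nonempty $K\subset\{1,\dots,n\}$ with $r=|K|$, $\mathring\Delta(n;K)=\{\mu\in\Delta(n):\mu_j>0\text{ for }j\in K,\ \mu_j=0\text{ for }j\notin K\}$, and $M(r;K)=\{(\mu,W)\in\mathcal{W}\mathcal{F}(n):\mu\in\mathring\Delta(n;K)\}$. The type $\tau(\mu)$ is the same for all $\mu\in\mathring\Delta(n;K)$ and is denoted $I(K)$, so $M(r;K)=\mathring\Delta(n;K)\times\mathcal{F}_{I(K)}$, with the product smooth structure, and $T_\mu\mathring\Delta(n;K)=\{\alpha\in\mathbb{R}^n:\alpha_j=0\text{ for }j\notin K,\ \sum_i\alpha_i=0\}$. The sets $M(r;K)$ are the cells of the stratification of $\mathcal{W}\mathcal{F}(n)$. For $i<j$, $\mu_{i\to j}\in[0,1]^n$ is the vector whose $l$-th entry is $\mu_l$ if $i\le l\le j-1$ and $0$ otherwise. *)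

(* Defs.v *)
From HB Require Import structures.
From mathcomp Require Import all_boot all_order all_algebra.
From mathcomp Require Import all_classical all_reals all_analysis.

Set Implicit Arguments.
Unset Strict Implicit.
Unset Printing Implicit Defensive.

Import Order.TTheory GRing.Theory Num.Theory.
Import numFieldNormedType.Exports.

Local Open Scope classical_set_scope.
Local Open Scope ring_scope.

Section Regularity.
Context {R : realType} {V W : normedModType R}.
Implicit Types (O S : set V) (h : V -> W).

(* On an open set O of a finite-dimensional space; for k > 0 this is
   "the partial derivatives exist and are of class C^(k-1)", the directions
   ranging over all vectors rather than over a basis. *)
Fixpoint Ck_open (k : nat) O h : Prop :=
  (forall x, O x -> {for x, continuous h}) /\
  if k is k'.+1 then
    forall v, (forall x, O x -> derivable h x v) /\ Ck_open k' O ('D_v h)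
  else True.

Definition smooth_open O h : Prop := forall k, Ck_open k O h.

(* On an arbitrary subset S: around each point of S, the function is the
   restriction of a function of the given class on an open set of V.  When S
   is an embedded submanifold this is the C^k class of the manifold S. *)
Definition locally_extends (C : set V -> (V -> W) -> Prop) S h : Prop :=
  forall x, S x -> exists O h',
    [/\ open O, O x, C O h' & forall y, O y -> S y -> h' y = h y].

Definition Ck_on (k : nat) S h : Prop := locally_extends (Ck_open k) S h.

Definition smooth_on S h : Prop := locally_extends smooth_open S h.

End Regularity.

(* There is a partition of [a, b] with P x y for each of its pieces [x, y]. *)
Definition piecewise {R : realType} (P : R -> R -> Prop) (a b : R) : Prop :=
  exists2 s : seq R, itv_partition a b s &
    forall i, (i < size s)%N -> P (nth b (a :: s) i) (nth b s i).

Section Flags.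
Context {R : realType} {n : nat}.
Implicit Types (I : seq nat) (U B : 'M[R]_n.+1) (W : set 'M[R]_n.+1).

Definition orthogonal_group : set 'M[R]_n.+1 := [set U | U^T *m U = 1%:M].

Definition skew : set 'M[R]_n.+1 := [set B | B^T = - B].

(* reshape_index I i is the number of the block of I containing i. *)
Definition same_block I (i j : 'I_n.+1) : bool :=
  reshape_index I i == reshape_index I j.

(* The group O(I). *)
Definition block_orthogonal I : set 'M[R]_n.+1 :=
  [set U | orthogonal_group U /\ forall i j, ~~ same_block I i j -> U i j = 0].

Definition horizontal_space I : set 'M[R]_n.+1 :=
  [set B | skew B /\ forall i j, same_block I i j -> B i j = 0].

(* A point of F_I = O(n) / O(I) is a left coset U O(I), as a set of matrices;
   flag_proj is the quotient map and flags I is the set F_I. *)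
Definition flag_proj I U : set 'M[R]_n.+1 :=
  [set U *m Q | Q in block_orthogonal I].

Definition flags I : set (set 'M[R]_n.+1) :=
  [set flag_proj I U | U in orthogonal_group].

(* The smooth structure of F_I, given by its algebra of smooth functions: in
   the unique structure making flag_proj I a smooth submersion, a function on
   F_I is smooth if and only if its pullback to O(n) is.  The values of such
   a function outside of F_I are irrelevant. *)
Record smooth_fun I := SmoothFun {
  smooth_val :> set 'M[R]_n.+1 -> R;
  _ : smooth_on orthogonal_group (smooth_val \o flag_proj I) }.

(* A map from S to F_I is of class C^k if its composition with every smooth
   function of F_I is. *)
Definition flag_Ck_on (V : normedModType R) I (k : nat) (S : set V)
    (c : V -> set 'M[R]_n.+1) : Prop :=
  (forall x, S x -> flags I (c x)) /\
  forall h : smooth_fun I, Ck_on k S (fun x => h (c x) : R).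

(* Tangent vectors of F_I act on smooth functions, and the velocity of a path
   c at time t is h |-> (h \o c)'(t). *)
Definition velocity I (c : R -> set 'M[R]_n.+1) (t : R) : smooth_fun I -> R :=
  fun h => derive1 (fun s => h (c s) : R) t.

Definition flag_tangent I W : set (smooth_fun I -> R) :=
  [set X | exists c : R -> set 'M[R]_n.+1,
     [/\ flag_Ck_on I 1 [set: R] c, c 0 = W & X = velocity c 0]].

(* X is the image of xi, tangent to O(n) at U, by the tangent map of
   flag_proj I at U: this map sends the velocity of a path of O(n) to the
   velocity of its image. *)
Definition is_dpi I U (xi : 'M[R]_n.+1) (X : smooth_fun I -> R) : Prop :=
  exists c : R -> 'M[R]_n.+1,
    [/\ Ck_on 1 [set: R] c /\ (forall t, orthogonal_group (c t)),
        c 0 = U, derive1 c 0 = xi & X = velocity (flag_proj I \o c) 0].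

Definition horizontal_lift I U (X : smooth_fun I -> R)
    (xi : 'M[R]_n.+1) : Prop :=
  (exists2 B, horizontal_space I B & xi = U *m B) /\ is_dpi U xi X.

End Flags.

Arguments smooth_fun R n I : clear implicits.

Section WeightedFlags.
Context {R : realType} {n : nat}.
Implicit Types (mu alpha : 'rV[R]_n.+1) (W : set 'M[R]_n.+1).
Implicit Types (K : {set 'I_n.+1}).

Definition cube : set 'rV[R]_n.+1 := [set mu | forall i, 0 <= mu 0 i <= 1].

Definition simplex : set 'rV[R]_n.+1 :=
  [set mu | cube mu /\ \sum_i mu 0 i = 1].

(* For K = {k_1 < ... < k_s}, the type (k_1, k_2 - k_1, ..., k_s - k_(s-1)),
   followed by n - k_s when this is nonzero; the indices are shifted because
   'I_n.+1 starts at 0. *)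
Definition type_of K : seq nat :=
  let ks := [seq (i : nat).+1 | i : 'I_n.+1 <- enum K] in
  let ps := pairmap (fun x y => y - x)%N 0%N ks in
  if last 0%N ks == n.+1 then ps else rcons ps (n.+1 - last 0%N ks)%N.

Definition tau mu : seq nat := type_of [set i | 0 < mu 0 i].

(* WF(n); the class of (mu, U) is the pair (mu, flag_proj (tau mu) U). *)
Definition weighted_flags : set ('rV[R]_n.+1 * set 'M[R]_n.+1) :=
  [set p | simplex p.1 /\ flags (tau p.1) p.2].

Definition open_simplex K : set 'rV[R]_n.+1 :=
  [set mu | simplex mu /\
     forall j, (j \in K -> 0 < mu 0 j) /\ (j \notin K -> mu 0 j = 0)].

(* M(r; K), with r = #|K|. *)
Definition cell K : set ('rV[R]_n.+1 * set 'M[R]_n.+1) :=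
  [set p | weighted_flags p /\ open_simplex K p.1].

Definition simplex_tangent K : set 'rV[R]_n.+1 :=
  [set alpha | (forall j, j \notin K -> alpha 0 j = 0) /\ \sum_i alpha 0 i = 0].

(* A vector space containing the tangent spaces of the cell of K. *)
Definition tvec K : Type :=
  ('rV[R]_n.+1 * (smooth_fun R n (type_of K) -> R))%type.

Definition cell_tangent K (p : 'rV[R]_n.+1 * set 'M[R]_n.+1) : set (tvec K) :=
  [set v | simplex_tangent K v.1 /\ flag_tangent p.2 v.2].

(* Regularity on the cell, read on Delta(n; K) x O(n) through the surjective
   submersion id x pi. *)
Definition cell_pull (E : Type) K
    (h : 'rV[R]_n.+1 * set 'M[R]_n.+1 -> E) : 'rV[R]_n.+1 * 'M[R]_n.+1 -> E :=
  fun p => h (p.1, flag_proj (type_of K) p.2).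

Definition cell_Ck (E : normedModType R) K (k : nat)
    (h : 'rV[R]_n.+1 * set 'M[R]_n.+1 -> E) : Prop :=
  Ck_on k (open_simplex K `*` orthogonal_group) (cell_pull K h).

Definition cell_smooth (E : normedModType R) K
    (h : 'rV[R]_n.+1 * set 'M[R]_n.+1 -> E) : Prop :=
  smooth_on (open_simplex K `*` orthogonal_group) (cell_pull K h).

Definition smooth_vector_field K
    (xi : 'rV[R]_n.+1 * set 'M[R]_n.+1 -> tvec K) : Prop :=
  [/\ forall p, cell K p -> cell_tangent p (xi p),
      cell_smooth K (fun p => (xi p).1)
    & forall h, cell_smooth K (fun p => (xi p).2 h : R)].

Definition inner_product_on (E : lmodType R) (T : set E) (b : E -> E -> R) :=
  [/\ T 0 /\ (forall (a : R) u v, T u -> T v -> T (a *: u + v)),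
      forall u v, T u -> T v -> b u v = b v u,
      forall (a : R) u v w, T u -> T v -> T w ->
        b (a *: u + v) w = a * b u w + b v w
    & forall u, T u -> u != 0 -> 0 < b u u].

(* A Riemannian metric of class C^k: an inner product on every tangent space
   whose evaluation on smooth vector fields is of class C^k. *)
Definition riemannian_metric (k : nat) K
    (g : 'rV[R]_n.+1 * set 'M[R]_n.+1 -> tvec K -> tvec K -> R) : Prop :=
  (forall p, cell K p -> inner_product_on (cell_tangent p) (g p)) /\
  forall xi eta, smooth_vector_field xi -> smooth_vector_field eta ->
    cell_Ck K k (fun p => g p (xi p) (eta p) : R).

Definition piecewise_C1_in_cell K (a b : R) (mu : R -> 'rV[R]_n.+1)
    (W : R -> set 'M[R]_n.+1) : Prop :=
  (forall t, t \in `[a, b] -> cell K (mu t, W t)) /\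
  piecewise (fun x y => Ck_on 1 `[x, y] mu /\
                        flag_Ck_on (type_of K) 1 `[x, y] W) a b.

Definition path_velocity K (mu : R -> 'rV[R]_n.+1) (W : R -> set 'M[R]_n.+1)
    (t : R) : tvec K :=
  (derive1 mu t, velocity W t).

Definition speed K (g : 'rV[R]_n.+1 * set 'M[R]_n.+1 -> tvec K -> tvec K -> R)
    (mu : R -> 'rV[R]_n.+1) (W : R -> set 'M[R]_n.+1) (t : R) : R :=
  let v := path_velocity K mu W t in Num.sqrt (g (mu t, W t) v v).

Definition path_length K
    (g : 'rV[R]_n.+1 * set 'M[R]_n.+1 -> tvec K -> tvec K -> R)
    (a b : R) (mu : R -> 'rV[R]_n.+1) (W : R -> set 'M[R]_n.+1) : R :=
  \int[lebesgue_measure]_(t in `[a, b]) speed g mu W t.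

(* The vector mu_(i -> j). *)
Definition window mu (i j : 'I_n.+1) : 'rV[R]_n.+1 :=
  \row_l (if (i <= l < j)%N then mu 0 l else 0).

Definition metric_formula (f : 'rV[R]_n.+1 -> R) mu
    (alpha beta : 'rV[R]_n.+1) (B C : 'M[R]_n.+1) : R :=
  \sum_i alpha 0 i * beta 0 i +
  \sum_(i < n.+1) \sum_(j < n.+1 | (i < j)%N)
    f (window mu i j) ^+ 2 * B i j * C i j.

(* The value of the formula for some choice of U and of the horizontal
   lifts; 0 if there is none. *)
Definition metric (f : 'rV[R]_n.+1 -> R) K
    (p : 'rV[R]_n.+1 * set 'M[R]_n.+1) (v w : tvec K) : R :=
  xget 0 [set y | exists U X Y,
    [/\ orthogonal_group U, flag_proj (type_of K) U = p.2,
        horizontal_lift U v.2 X, horizontal_lift U w.2 Y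
      & y = metric_formula f p.1 v.1 w.1 (U^T *m X) (U^T *m Y)]].

End WeightedFlags.

Arguments tvec R n K : clear implicits.

(* Main.v *)
Require Import Defs.
From HB Require Import structures.
From mathcomp Require Import all_boot all_order all_algebra.
From mathcomp Require Import all_classical all_reals all_analysis.
From mathcomp Require Import measurable_realfun ring.

Set Implicit Arguments.
Unset Strict Implicit.
Unset Printing Implicit Defensive.

Import Order.TTheory GRing.Theory Num.Theory.
Import numFieldNormedType.Exports.

Local Open Scope classical_set_scope.
Local Open Scope ring_scope.

(** The flag of U, that is the coset U O(I), is encoded by the symmetric matrix
    P(U) = U D U^T, where D is diagonal with one eigenvalue for each block of
    I: since O(I) is the group of the orthogonal matrices commuting with D,
    two frames have the same flag exactly when they have the same P
    (flag_proj_eqP).  The entries of P are smooth functions on the flag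
    manifold.  A tangent vector X, image of the direction U B, takes on them
    the values U [B, D] U^T (pushes_flag_coord), and the entries of [B, D] are
    those of B multiplied by the differences of eigenvalues.  Hence the
    off-diagonal blocks of B are explicit functions of U and of finitely many
    values of X.  This gives the uniqueness of the horizontal lift, the rule
    B -> Q^T B Q for a change of frame U -> U Q (pushes_change_frame), and the
    smoothness of the lift of a smooth vector field.

    Existence of the horizontal lift (flag_tangentP).  A C^1 path of flags has
    to be lifted to a path of frames differentiable at time 0.  In each coset
    take the frame closest to U: it maximizes the trace of H = U^T V over the
    frames V of the flag.  Testing maximality against rotations and
    reflections inside the blocks, the diagonal part of H is symmetric and
    positive semi-definite; as H is orthogonal, it then differs from the
    identity by at most the square of the off-diagonal part
    (trace_max_close), while the off-diagonal part is determined by P to first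
    order.  So the closest frame is differentiable at 0, with a horizontal
    derivative (flag_lift).  Conversely, every horizontal direction is the
    velocity of a Cayley curve.  As tangent vectors are defined by their
    action on smooth functions, all this relies on the chain rule along curves
    (cvg_slope_comp).

    Well-definedness and positivity.  The window of (i, j) depends only on the
    blocks of i and j, and it vanishes exactly when these blocks coincide.
    Weights that are constant on blocks commute with the conjugation by a
    block-diagonal orthogonal matrix, so the formula does not depend on the
    frame (upper_sum_block_congr, metricE); and it is positive definite on
    horizontal directions, because f is positive away from 0.  It is of class
    C^2 on the cell: within a block the weight is identically 0, and otherwise
    the window stays in the domain where f is of class C^2.

    Length.  Where U is differentiable, the velocity of W is the image of
    U U^T U'.  The diagonal blocks of the skew-symmetric matrix U^T U' are
    vertical, and the weights ignore them, so both speeds agree there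
    (speed_lifted).  Off a finite set the lifted speed is continuous and
    bounded, which gives the integrability and the equality of the
    integrals. *)

(** * Functions of class C^k on open sets *)

Section CkOpen.
Context {R : realType}.

Section General.
Context {V W : normedModType R}.
Implicit Types (O : set V) (h : V -> W).

Lemma open_eq_near O h h' x : open O -> O x ->
  (forall y, O y -> h y = h' y) -> {near x, h =1 h'}.
Proof. by move=> oO Ox e; apply: filterS (open_nbhs_nbhs (conj oO Ox)). Qed.

Lemma near_eq_continuous_at h h' x :
  {near x, h =1 h'} -> {for x, continuous h} -> {for x, continuous h'}.
Proof.
move=> e; rewrite /prop_for /continuous_at => ch.
have <- : h x = h' x := nbhs_singleton e.
by apply: cvg_trans ch; apply: near_eq_cvg; apply: filterS e.
Qed.

Lemma Ck_open_ext k O h h' : open O -> (forall x, O x -> h x = h' x) ->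
  Ck_open k O h -> Ck_open k O h'.
Proof.
move=> oO; elim: k h h' => [|k IH] h h' e /= [ch dh]; split => //.
- by move=> x Ox; apply: near_eq_continuous_at (ch _ Ox); exact: open_eq_near e.
- by move=> x Ox; apply: near_eq_continuous_at (ch _ Ox); exact: open_eq_near e.
move=> v; have [dv cv] := dh v; split.
  by move=> x Ox; apply: near_eq_derivable (dv _ Ox); exact: open_eq_near e.
by apply: IH cv => x Ox; apply: near_eq_derive; exact: open_eq_near e.
Qed.

Lemma Ck_open_sub k O O' h : O' `<=` O -> Ck_open k O h -> Ck_open k O' h.
Proof.
move=> s; elim: k h => [|k IH] h /= [ch dh]; split => //.
- by move=> x /s; exact: ch.
- by move=> x /s; exact: ch.
by move=> v; have [dv cv] := dh v; split => [x /s|]; [exact: dv|exact: IH].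
Qed.

Lemma Ck_openS k O h : Ck_open k.+1 O h -> Ck_open k O h.
Proof.
elim: k h => [|k IH] h [ch dh]; split => // v.
by have [dv cv] := dh v; split => //; exact: IH.
Qed.

Lemma Ck_open_cst k O (w : W) : Ck_open k O (cst w).
Proof.
elim: k w => [|k IH] w; split => //.
- by move=> x _; exact: cst_continuous.
- by move=> x _; exact: cst_continuous.
move=> v; split; first by move=> x _; exact: derivable_cst.
rewrite (_ : 'D_v _ = cst 0); first exact: IH.
by apply/funext => x; rewrite derive_cst.
Qed.

Lemma Ck_openD k O h h' : open O ->
  Ck_open k O h -> Ck_open k O h' -> Ck_open k O (fun x => h x + h' x).
Proof.
move=> oO; elim: k h h' => [|k IH] h h' /= [ch dh] [ch' dh']; split => //.
- by move=> x Ox; apply: continuousD; [exact: ch|exact: ch'].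
- by move=> x Ox; apply: continuousD; [exact: ch|exact: ch'].
move=> v; have [dv cv] := dh v; have [dv' cv'] := dh' v; split.
  by move=> x Ox; apply: derivableD; [exact: dv|exact: dv'].
apply: Ck_open_ext (IH _ _ cv cv') => // x Ox /=.
by rewrite deriveD //; [exact: dv|exact: dv'].
Qed.

End General.

Lemma Ck_open_comp_linear k (V V' W : normedModType R) (L : V' -> V)
    O (h : V -> W) : continuous L ->
  (forall (a : R) u v, L (a *: u + v) = a *: L u + L v) ->
  Ck_open k O h -> Ck_open k (L @^-1` O) (h \o L).
Proof.
move=> cL lL; elim: k h => [|k IH] h [ch dh].
  by split => // x Ox; apply: continuous_comp; [exact: cL|exact: ch].
have e v x : (fun t : R => t^-1 *: (((h \o L) \o shift x) (t *: v) - (h \o L) x))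
     = (fun t => t^-1 *: ((h \o shift (L x)) (t *: L v) - h (L x))).
  by apply/funext => t /=; rewrite lL.
split; first by move=> x Ox; apply: continuous_comp; [exact: cL|exact: ch].
move=> v; have [dv cv] := dh (L v); split.
  by move=> x Ox; rewrite /derivable e; exact: dv.
rewrite (_ : 'D_v _ = 'D_(L v) h \o L); first exact: IH.
by apply/funext => x; rewrite /derive e.
Qed.

Section Scalar.
Context {V : normedModType R}.
Implicit Types (O : set V) (h : V -> R).

Lemma Ck_openM k O h h' : open O ->
  Ck_open k O h -> Ck_open k O h' -> Ck_open k O (fun x => h x * h' x).
Proof.
move=> oO; elim: k h h' => [|k IH] h h' H H'.
  case: H H' => [ch dh] [ch' dh']; split => //.
  by move=> x Ox; apply: continuousM; [exact: ch|exact: ch'].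
have [ch dh] := H; have [ch' dh'] := H'; split => //.
  by move=> x Ox; apply: continuousM; [exact: ch|exact: ch'].
move=> v; have [dv cv] := dh v; have [dv' cv'] := dh' v; split.
  by move=> x Ox; apply: derivableM; [exact: dv|exact: dv'].
apply: (Ck_open_ext oO _
  (Ck_openD oO (IH _ _ (Ck_openS H) cv') (IH _ _ (Ck_openS H') cv))) => x Ox /=.
by rewrite deriveM //; [exact: dv|exact: dv'].
Qed.

Lemma Ck_open_sum k O (I : Type) (r : seq I) (P : pred I) (F : I -> V -> R) :
  open O -> (forall i, P i -> Ck_open k O (F i)) ->
  Ck_open k O (fun x => \sum_(i <- r | P i) F i x).
Proof.
move=> oO HF; elim: r => [|i r IH].
  by apply: (Ck_open_ext oO _ (Ck_open_cst k O (0 : R))) => x _; rewrite big_nil.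
have [Pi|nPi] := boolP (P i).
  by apply: Ck_open_ext (Ck_openD oO (HF _ Pi) IH) => // x _; rewrite big_cons Pi.
by apply: Ck_open_ext IH => // x _; rewrite big_cons (negbTE nPi).
Qed.

Lemma Ck_open_prod k O (I : Type) (r : seq I) (F : I -> V -> R) :
  open O -> (forall i, Ck_open k O (F i)) ->
  Ck_open k O (fun x => \prod_(i <- r) F i x).
Proof.
move=> oO HF; elim: r => [|i r IH].
  by apply: (Ck_open_ext oO _ (Ck_open_cst k O (1 : R))) => x _; rewrite big_nil.
by apply: Ck_open_ext (Ck_openM oO (HF i) IH) => // x _; rewrite big_cons.
Qed.

Lemma Ck_openV k O h : open O -> (forall x, O x -> h x != 0) ->
  Ck_open k O h -> Ck_open k O (fun x => (h x)^-1).
Proof.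
move=> oO h0; elim: k => [|k IH] H.
  case: H => ch _; split => // x Ox; apply: continuousV; first exact: h0.
  exact: ch.
have [ch dh] := H; split.
  by move=> x Ox; apply: continuousV; [exact: h0|exact: ch].
move=> v; have [dv cv] := dh v; split.
  by move=> x Ox; apply: derivableV; [exact: h0|exact: dv].
have HV := IH (Ck_openS H).
apply: (Ck_open_ext oO _ (Ck_openM oO (Ck_open_cst k O (-1 : R))
   (Ck_openM oO (Ck_openM oO HV HV) cv))) => x Ox /=.
rewrite deriveV; [|exact: h0|exact: dv].
by rewrite /GRing.scale/= mulN1r mulNr expr2 invfM.
Qed.

End Scalar.

Lemma Ck_open_id k (O : set R) : Ck_open k O (id : R -> R).
Proof.
case: k => [|k]; split => //.
- by move=> x _; exact: cvg_id.
- by move=> x _; exact: cvg_id.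
move=> v; split; first by move=> x _; exact: derivable_id.
rewrite (_ : 'D_v _ = cst v); first exact: Ck_open_cst.
by apply/funext => x; rewrite derive_id.
Qed.

End CkOpen.

(** * Matrix-valued functions and the chain rule *)

Lemma near_cvg (T : Type) (U : topologicalType) (F : set_system T)
    {FF : Filter F} (f g : T -> U) (l : U) :
  {near F, f =1 g} -> f @ F --> l -> g @ F --> l.
Proof. by move=> e; apply: cvg_trans; exact: near_eq_cvg. Qed.

Lemma is_derive_slopeP (R : realType) (W : normedModType R) (c : R -> W)
    (t0 : R) (l : W) : is_derive t0 1 c l <->
  (fun t => t^-1 *: (c (t + t0) - c t0)) @ 0^' --> l.
Proof.
have E : (fun t : R => t^-1 *: ((c \o shift t0) (t *: (1 : R)) - c t0)) =
    (fun t => t^-1 *: (c (t + t0) - c t0)).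
  by apply/funext => t /=; rewrite /GRing.scale/= mulr1.
split=> [[dc <-]|H]; first by have := dc; rewrite /derivable /derive E.
apply: DeriveDef; first by rewrite /derivable E; apply/cvg_ex; exists l.
by rewrite /derive E; exact: cvg_lim.
Qed.

Lemma is_derive_slope0P (R : realType) (W : normedModType R) (c : R -> W) (l : W) :
  is_derive (0 : R) 1 c l <-> (fun t => t^-1 *: (c t - c 0)) @ 0^' --> l.
Proof.
by rewrite is_derive_slopeP; under eq_fun do rewrite addr0.
Qed.
Section Matrices.
Context {R : realType} {m n : nat}.

Lemma cvg_mx (T : Type) (F : set_system T) (M : T -> 'M[R]_(m, n))
    (l : 'M[R]_(m, n)) :
  Filter F -> (forall i j, (fun t => M t i j) @ F --> l i j) -> M @ F --> l.
Proof.
move=> FF H; apply/cvgrPdist_le => e e0; near=> x.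
rewrite /Num.Def.normr/= mx_normrE (bigmax_le _ (ltW e0))//= => i _.
rewrite !mxE/=.
move: i; near: x; apply: filter_forall => /= i.
exact: ((cvgrPdist_le _ _).1 (H i.1 i.2)).
Unshelve. all: by end_near. Qed.

Lemma Ck_open_mxP (V : normedModType R) k (O : set V)
    (M : V -> 'M[R]_(m, n)) : open O ->
  Ck_open k O M <-> forall i j, Ck_open k O (fun x => M x i j).
Proof.
move=> oO; elim: k M => [|k IH] M; split.
- move=> [cM _] i j; split => // x Ox.
  apply: (@continuous_comp _ _ _ M (fun A : 'M[R]_(m, n) => A i j)).
      exact: cM.
    exact: coord_continuous.
- move=> H; split => // x Ox; apply: cvg_mx => i j.
  by have [/(_ x Ox)] := H i j.
- move=> [cM dM] i j; split.
    move=> x Ox.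
    apply: (@continuous_comp _ _ _ M (fun A : 'M[R]_(m, n) => A i j)).
      exact: cM.
    exact: coord_continuous.
  move=> v; have [dv cv] := dM v; split.
    by move=> x /dv/derivable_mxP; apply.
  move/(IH _): cv => /(_ i j); apply: Ck_open_ext => // x Ox.
  by rewrite derive_mx ?mxE//; exact: dv.
- move=> H; split.
    move=> x Ox; apply: cvg_mx => i j.
    by have [/(_ x Ox)] := H i j.
  move=> v.
  have dv x : O x -> derivable M x v.
    move=> Ox; apply/derivable_mxP => i j.
    by have [_ /(_ v)[/(_ x Ox)]] := H i j.
  split => //; apply/IH => i j; have [_ /(_ v)[_]] := H i j.
  by apply: Ck_open_ext => // x Ox; rewrite derive_mx ?mxE//; exact: dv.
Qed.

Lemma Ck_open_coord k (O : set 'M[R]_(m, n)) i j :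
  open O -> Ck_open k O (fun M => M i j).
Proof.
move=> oO; apply: (@Ck_open_sub _ _ _ _ ((fun M : 'M[R]_(m, n) => M i j) @^-1` setT)) => //.
apply: (@Ck_open_comp_linear _ k _ _ _ (fun M : 'M[R]_(m, n) => M i j) setT id).
- exact: coord_continuous.
- by move=> a u v; rewrite !mxE.
exact: Ck_open_id.
Qed.

End Matrices.

Section ChainRule.
Context {R : realType} {V : normedModType R}.
Implicit Types (h : V -> R) (O : set V).

Lemma MVT_line h (x e : V) (a : R) :
  (forall s : R, `|s| <= `|a| -> derivable h (x + s *: e) e) ->
  exists2 s : R, `|s| <= `|a| & h (x + a *: e) - h x = a * 'D_e h (x + s *: e).
Proof.
move=> dh; pose phi (s : R) := h (x + s *: e).
have slope (s : R) : (fun t : R => t^-1 *: ((phi \o shift s) (t *: (1 : R)) - phi s)) =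
    (fun t => t^-1 *: ((h \o shift (x + s *: e)) (t *: e) - h (x + s *: e))).
  by apply/funext => t /=; rewrite /phi scalerDl addrCA /GRing.scale/= mulr1.
have dphi (s : R) : `|s| <= `|a| -> is_derive s (1 : R) phi ('D_e h (x + s *: e)).
  move=> /dh ds; apply: DeriveDef; first by rewrite /derivable slope.
  by rewrite /derive slope.
have phi0 : phi 0 = h x by rewrite /phi scale0r addr0.
have [a0|a0] := leP 0 a.
  have ab (s : R) : s \in `[0, a] -> `|s| <= `|a|.
    by rewrite in_itv/= => /andP[s0 sa]; rewrite !ger0_norm.
  have [||c cab E] := MVT_segment (f := phi) (df := fun s => 'D_e h (x + s *: e)) a0.
  - by move=> s sab; apply/dphi/ab; apply: subset_itv_oo_cc.
  - apply: derivable_within_continuous => s /ab/dphi ds; exact: ex_derive.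
  - by exists c; [exact: ab|rewrite -/(phi a) -phi0 E subr0 mulrC].
have ab (s : R) : s \in `[a, 0] -> `|s| <= `|a|.
  by rewrite in_itv/= => /andP[s0 sa]; rewrite !ler0_norm ?lerN2// ltW.
have [||c cab E] := MVT_segment (f := phi) (df := fun s => 'D_e h (x + s *: e)) (ltW a0).
- by move=> s sab; apply/dphi/ab; apply: subset_itv_oo_cc.
- apply: derivable_within_continuous => s /ab/dphi ds; exact: ex_derive.
- exists c; first exact: ab.
  by rewrite -/(phi a) -phi0 -opprB E sub0r mulrN opprK mulrC.
Qed.

Lemma cvg_slope0 (a : R -> R) (l : R) :
  (fun t => t^-1 * a t) @ 0^' --> l -> a @ 0^' --> (0 : R).
Proof.
move=> al; have t0 : id @ (0 : R)^' --> (0 : R).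
  exact: nbhs_dnbhs.
have H : (fun t => t * (t^-1 * a t)) @ 0^' --> 0 * l by exact: cvgM.
rewrite mul0r in H; apply: near_cvg H.
near=> t; rewrite /= mulrA mulfV ?mul1r//.
by near: t; exact: nbhs_dnbhs_neq.
Unshelve. all: by end_near. Qed.

Lemma cvg_sum_seq (W : normedModType R) (T : Type) (F : set_system T) (I : Type) (s : seq I) (P : pred I)
    (f : I -> T -> W) (l : I -> W) : Filter F ->
  (forall i, P i -> f i @ F --> l i) ->
  (fun t => \sum_(i <- s | P i) f i t) @ F --> \sum_(i <- s | P i) l i.
Proof. by move=> FF fl; apply: cvg_big => //; exact: add_continuous. Qed.

(** The chain rule along a curve, in terms of difference quotients at 0.  The
    increments along the vectors e i are added one at a time, and each of them
    is evaluated by the mean value theorem and the continuity of the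
    directional derivative, so that the curve need only be differentiable at
    the point considered. *)
Lemma cvg_slope_comp h O (x0 : V) (I : Type) (s : seq I) (e : I -> V)
    (a : I -> R -> R) (l : I -> R) :
  open O -> O x0 -> Ck_open 1 O h ->
  (forall i, (fun t => t^-1 * a i t) @ 0^' --> l i) ->
  (fun t => t^-1 * (h (x0 + \sum_(i <- s) a i t *: e i) - h x0)) @ 0^' -->
    \sum_(i <- s) l i * 'D_(e i) h x0.
Proof.
move=> oO Ox0 [ch dh] al; elim: s => [|k s IH].
  rewrite big_nil; apply: near_cvg (cvg_cst (0 : R)).
  by near=> t; rewrite big_nil addr0 subrr mulr0.
pose y t := x0 + \sum_(i <- s) a i t *: e i.
have a0 i : a i @ 0^' --> (0 : R) by exact: cvg_slope0 (al i).
have y0 : y @ 0^' --> x0.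
  rewrite -[X in _ --> X]addr0; apply: cvgD; first exact: cvg_cst.
  rewrite -[X in _ --> X](_ : \sum_(i <- s) 0 *: e i = 0); last first.
    by rewrite big1 // => i _; rewrite scale0r.
  by apply: cvg_sum_seq => i _; exact: cvgZr_tmp.
have [dek cek] := dh (e k).
(* The function th selects the intermediate points of the mean value theorem;
   they tend to 0 with the increments. *)
have near_th : \forall t \near (0 : R)^', exists th : R, `|th| <= `|a k t| /\
    h (y t + a k t *: e k) - h (y t) = a k t * 'D_(e k) h (y t + th *: e k).
  have /nbhs_ballP[r /= r0 rO] := open_nbhs_nbhs (conj oO Ox0).
  have r2 : 0 < r / 2 by rewrite divr_gt0.
  have ae0 : (fun t => a k t *: e k) @ 0^' --> (0 : V).
    by rewrite -(scale0r (e k)); exact: cvgZr_tmp.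
  near=> t; have [|th H1 H2] := @MVT_line h (y t) (e k) (a k t); last by exists th.
  move=> u ua; apply: dek; apply: rO; rewrite -ball_normE /=.
  rewrite opprD addrA (le_lt_trans (ler_normB _ _))//.
  rewrite (splitr r) ltrD//.
    by near: t; apply: cvgr_dist_lt => //; exact: y0.
  rewrite normrZ (le_lt_trans (ler_wpM2r (normr_ge0 _) ua))// -normrZ.
  by near: t; apply: cvgr0_norm_lt => //; exact: ae0.
pose th t := xget 0 [set u : R | `|u| <= `|a k t| /\
    h (y t + a k t *: e k) - h (y t) = a k t * 'D_(e k) h (y t + u *: e k)].
have {near_th} th_spec : \forall t \near (0 : R)^', `|th t| <= `|a k t| /\
    h (y t + a k t *: e k) - h (y t) = a k t * 'D_(e k) h (y t + th t *: e k).
  by apply: filterS near_th => t /(xgetPex 0).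
have th0 : th @ 0^' --> (0 : R).
  apply/cvgrPdist_lt => eps eps0; near=> t; rewrite sub0r normrN.
  apply: (@le_lt_trans _ _ `|a k t|).
    by near: t; apply: filterS th_spec => t [].
  by near: t; apply: cvgr0_norm_lt => //; exact: a0.
have Dth : (fun t => 'D_(e k) h (y t + th t *: e k)) @ 0^' --> 'D_(e k) h x0.
  have xi0 : (fun t => y t + th t *: e k) @ 0^' --> x0.
    rewrite -[X in _ --> X]addr0 -[X in _ + X](scale0r (e k)).
    by apply: cvgD => //; exact: cvgZr_tmp.
  by case: cek => /(_ x0 Ox0) cek _; exact: (cvg_comp _ _ xi0 cek).
rewrite big_cons.
apply: (near_cvg _ (cvgD (cvgM (al k) Dth) IH)).
apply: filterS th_spec => t [_ E].
rewrite big_cons [a k t *: e k + _]addrC addrA -/(y t).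
rewrite /= fctE /= -mulrA -E -/(y t) -mulrDr; congr (_ * _).
by rewrite addrA subrK.
Unshelve. all: by end_near. Qed.

End ChainRule.

Section Directional.
Context {R : realType} {V : normedModType R}.
Implicit Types (h : V -> R) (O : set V).

(** The chain rule along a straight line: for a function of class C^1 the
    directional derivative is linear in the direction. *)
Lemma derive_sum_direction O h (x : V) (I : Type) (s : seq I) (l : I -> R)
    (e : I -> V) : open O -> O x -> Ck_open 1 O h ->
  'D_(\sum_(i <- s) l i *: e i) h x = \sum_(i <- s) l i * 'D_(e i) h x.
Proof.
move=> oO Ox ch.
have al i : (fun t : R => t^-1 * (t * l i)) @ 0^' --> l i.
  apply: (near_cvg _ (cvg_cst (l i))); near=> t.
  rewrite mulrA mulVf ?mul1r//.
  by near: t; exact: nbhs_dnbhs_neq.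
apply/cvg_lim => //; have H := cvg_slope_comp (s := s) (e := e) oO Ox ch al.
refine (near_cvg _ H).
near=> t => /=; congr (_ * (h _ - _)); rewrite scaler_sumr addrC.
by congr (_ + _); apply: eq_bigr => i _; rewrite scalerA.
Unshelve. all: by end_near. Qed.

Lemma derive_linear_direction O h (x u v : V) (a : R) :
  open O -> O x -> Ck_open 1 O h ->
  'D_(a *: u + v) h x = a * 'D_u h x + 'D_v h x.
Proof.
move=> oO Ox ch.
have := derive_sum_direction [:: true; false] (fun b => if b then a else 1)
  (fun b => if b then u else v) oO Ox ch.
by rewrite !big_cons !big_nil /= !addr0 scale1r mul1r.
Qed.

End Directional.

Section CurveComposition.
Context {R : realType} {V : normedModType R} {m n : nat}.
Implicit Types (h : 'M[R]_(m, n) -> R) (c : V -> 'M[R]_(m, n)).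

Lemma mx_sum_delta (A : 'M[R]_(m, n)) :
  A = \sum_(p : 'I_m * 'I_n) A p.1 p.2 *: delta_mx p.1 p.2.
Proof. by rewrite [LHS]matrix_sum_delta pair_bigA. Qed.

Lemma derive_mx_direction O h A B : open O -> O A -> Ck_open 1 O h ->
  'D_B h A = \sum_(p : 'I_m * 'I_n) B p.1 p.2 * 'D_(delta_mx p.1 p.2) h A.
Proof.
by move=> oO OA ch; rewrite [in LHS](mx_sum_delta B) (derive_sum_direction _ _ _ oO OA ch).
Qed.

Lemma is_derive_mx_comp O h c (x v : V) : open O -> O (c x) ->
  Ck_open 1 O h -> derivable c x v ->
  is_derive x v (h \o c) ('D_('D_v c x) h (c x)).
Proof.
move=> oO Ox ch dc.
have al (p : 'I_m * 'I_n) : (fun t : R => t^-1 * (c (t *: v + x) p.1 p.2 - c x p.1 p.2)) @ 0^'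
    --> ('D_v c x) p.1 p.2.
  by rewrite derive_mx // mxE; exact: (derivable_mxP c x v).1.
suff H : (fun t : R => t^-1 *: (((h \o c) \o shift x) (t *: v) - (h \o c) x)) @ 0^'
    --> 'D_('D_v c x) h (c x).
  by apply: DeriveDef; [apply/cvg_ex; exists ('D_('D_v c x) h (c x))|exact: cvg_lim].
rewrite (derive_mx_direction _ oO Ox ch).
have H := cvg_slope_comp (s := index_enum _) (e := fun p => delta_mx p.1 p.2) oO Ox ch al.
refine (near_cvg _ H).
near=> t => /=; congr (_ * (h _ - _)).
rewrite -[RHS](subrKC (c x)); congr (_ + _).
by rewrite [RHS]mx_sum_delta; apply: eq_bigr => p _; rewrite !mxE.
Unshelve. all: by end_near. Qed.

Lemma open_preimage_on (O : set V) (O' : set 'M[R]_(m, n)) c :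
  open O -> open O' -> (forall x, O x -> {for x, continuous c}) ->
  open (O `&` c @^-1` O').
Proof.
move=> oO oO' cc; rewrite openE => x [Ox O'x]; apply: filterI.
  exact: open_nbhs_nbhs.
by apply: (cc _ Ox); exact: open_nbhs_nbhs.
Qed.

Lemma C1_open_mx_comp O O' h c : open O -> open O' ->
  Ck_open 1 O c -> Ck_open 1 O' h -> Ck_open 1 (O `&` c @^-1` O') (h \o c).
Proof.
move=> oO oO' Hc Hh; have [cc dc] := Hc; have [hc dh] := Hh.
have oOO := open_preimage_on oO oO' cc.
split=> [x [Ox O'x]|v].
  by apply: continuous_comp; [exact: cc|exact: hc].
have D x : (O `&` c @^-1` O') x -> is_derive x v (h \o c) ('D_('D_v c x) h (c x)).
  by move=> [Ox O'x]; apply: is_derive_mx_comp oO' O'x Hh _; have [/(_ x Ox)] := dc v.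
split=> [x Ox|]; first by have := D x Ox => ?; exact: ex_derive.
apply: (@Ck_open_ext _ _ _ 0 _ (fun x =>
   \sum_(p : 'I_m * 'I_n) ('D_v c x) p.1 p.2 * 'D_(delta_mx p.1 p.2) h (c x))) => //.
  move=> x Ox; have [_ O'x] := Ox; have := D x Ox => dx.
  by rewrite derive_val (derive_mx_direction _ oO' O'x Hh).
apply: Ck_open_sum => // p _; apply: Ck_openM => //.
  have [_ cDc] := dc v; apply: Ck_open_sub (_ : Ck_open 0 O _); first by move=> x [].
  exact: ((Ck_open_mxP 0 _ oO).1 cDc p.1 p.2).
split => // x [Ox O'x].
apply: (@continuous_comp _ _ _ c ('D_(delta_mx p.1 p.2) h)); first exact: cc.
by have [_ [cD _]] := dh (delta_mx p.1 p.2); exact: cD.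
Qed.

End CurveComposition.

(** * Functions of class C^k on arbitrary sets *)

Section CkOn.
Context {R : realType} {V : normedModType R}.
Implicit Types (S : set V).

Lemma smooth_Ck_on (W : normedModType R) k S (h : V -> W) :
  smooth_on S h -> Ck_on k S h.
Proof.
by move=> H x /H [ O [h' [oO Ox sh e]]]; exists O, h'; split => //; exact: sh.
Qed.

Lemma Ck_on_ext (W : normedModType R) k S (h h' : V -> W) :
  (forall x, S x -> h x = h' x) -> Ck_on k S h -> Ck_on k S h'.
Proof.
move=> e H x /H [ O [g [oO Ox sh eg]]]; exists O, g; split => // y Oy Sy.
by rewrite eg // e.
Qed.

Lemma Ck_on_cst (W : normedModType R) k S (w : W) : Ck_on k S (cst w).
Proof.
move=> x _; exists setT, (cst w); split => //; first exact: openT.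
exact: Ck_open_cst.
Qed.

Lemma Ck_on_map2 (W1 W2 W : normedModType R) (op : W1 -> W2 -> W) k S
    (f : V -> W1) (g : V -> W2) :
  (forall O (f' : V -> W1) (g' : V -> W2), open O -> Ck_open k O f' -> Ck_open k O g' ->
     Ck_open k O (fun x => op (f' x) (g' x))) ->
  Ck_on k S f -> Ck_on k S g -> Ck_on k S (fun x => op (f x) (g x)).
Proof.
move=> Hop Hf Hg x Sx; have [ O [f' [oO Ox sf ef]]] := Hf x Sx.
have [ O' [g' [oO' O'x sg eg]]] := Hg x Sx.
exists (O `&` O'), (fun x => op (f' x) (g' x)); split => //.
- exact: openI.
- apply: Hop; first exact: openI.
    by apply: Ck_open_sub sf => ? [].
  by apply: Ck_open_sub sg => ? [].
- by move=> y [Oy O'y] Sy; rewrite ef // eg.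
Qed.

Lemma Ck_onD k S (f g : V -> R) :
  Ck_on k S f -> Ck_on k S g -> Ck_on k S (fun x => f x + g x).
Proof. by apply: (Ck_on_map2 (op := +%R)) => O f' g' oO ? ?; exact: Ck_openD. Qed.

Lemma Ck_onM k S (f g : V -> R) :
  Ck_on k S f -> Ck_on k S g -> Ck_on k S (fun x => f x * g x).
Proof. by apply: (Ck_on_map2 (op := fun a b : R => a * b)) => O f' g' oO ? ?; exact: Ck_openM. Qed.

Lemma Ck_on_sum k S (I : Type) (r : seq I) (P : pred I) (F : I -> V -> R) :
  (forall i, P i -> Ck_on k S (F i)) ->
  Ck_on k S (fun x => \sum_(i <- r | P i) F i x).
Proof.
move=> HF; elim: r => [|i r IH].
  by apply: (Ck_on_ext _ (@Ck_on_cst _ k S (0 : R))) => x _; rewrite big_nil.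
have [Pi|nPi] := boolP (P i).
  by apply: (Ck_on_ext _ (Ck_onD (HF _ Pi) IH)) => x _; rewrite big_cons Pi.
by apply: (Ck_on_ext _ IH) => x _; rewrite big_cons (negbTE nPi).
Qed.

Lemma Ck_on_mx_coord k S m n (M : V -> 'M[R]_(m, n)) i j :
  Ck_on k S M -> Ck_on k S (fun x => M x i j).
Proof.
move=> H x /H [ O [M' [oO Ox sM eM]]]; exists O, (fun x => M' x i j); split => //.
  exact: ((Ck_open_mxP k M' oO).1 sM).
by move=> y Oy Sy; rewrite eM.
Qed.

Lemma Ck_on_comp_linear (V' W : normedModType R) k S (S' : set V') (L : V' -> V)
    (h : V -> W) : continuous L ->
  (forall (a : R) u v, L (a *: u + v) = a *: L u + L v) ->
  (forall x, S' x -> S (L x)) -> Ck_on k S h -> Ck_on k S' (h \o L).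
Proof.
move=> cL lL SS H x /SS /H [ O [h' [oO Ox sh eh]]].
exists (L @^-1` O), (h' \o L); split => //.
- by apply: open_comp => // y _; exact: cL.
- exact: Ck_open_comp_linear.
- by move=> y Oy /SS Sy /=; rewrite eh.
Qed.

End CkOn.

(** * Blocks of the type of a set of indices *)

Section TypeOf.
Local Open Scope nat_scope.

(** The partial sums of the successive differences of an increasing sequence
    are its own entries, so that the block of i is the number of entries up to
    i.  The tail tl stands for the block which may follow the last entry. *)
Lemma reshape_index_pairmap (ks tl : seq nat) (x i : nat) :
  path ltn x ks -> x <= i -> reshape_index tl (i - last x ks) = 0 ->
  reshape_index (pairmap (fun y z => z - y) x ks ++ tl) (i - x) =
    count (fun k => k <= i) ks.
Proof.
elim: ks x => [|k ks IH] x //= /andP[xk pk] xi tl0.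
have [ki|ik] := leqP k i; last first.
  rewrite /reshape_index /= ifT; last by rewrite -subSn // subn_eq0 leq_sub2r.
  rewrite add0n; apply/esym/eqP; rewrite -leqn0 leqNgt -has_count -all_predC.
  apply/allP => y yks /=; rewrite -ltnNge (ltn_trans ik)//.
  by move: pk; rewrite (path_sortedE ltn_trans) => /andP[/allP/(_ y yks)].
have E : (i - x).+1 - (k - x) = (i - k).+1.
  by rewrite -subSn // subnBA ?subnK ?subSn// ltnW// ltnW.
by rewrite /reshape_index /= E /= add1n -(IH k pk ki tl0).
Qed.

Lemma reshape_index_type_of (n : nat) (K : {set 'I_n.+1}) (i : 'I_n.+1) :
  reshape_index (type_of K) i = #|[set k in K | k < i]%SET|.
Proof.
rewrite /type_of; set ks := [seq _ | _ <- _].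
have pks : path ltn 0 ks.
  rewrite (path_sortedE ltn_trans); apply/andP; split.
    by apply/allP => y /mapP[k _ ->].
  rewrite (_ : ks = map succn (map val (enum K))); last by rewrite -map_comp.
  rewrite sorted_map; apply: (@subseq_sorted _ ltn ltn_trans _ _ _ (iota_ltn_sorted 0 n.+1)).
  rewrite -val_enum_ord; apply: map_subseq.
  by rewrite enumT /enum_mem; exact: filter_subseq.
have cks : count (fun k => k <= i) ks = #|[set k in K | k < i]%SET|.
  rewrite count_map cardE -size_filter; apply/perm_size/uniq_perm.
  - by rewrite filter_uniq // enum_uniq.
  - exact: enum_uniq.
  - by move=> k; rewrite mem_filter !mem_enum finset.in_set andbC.
rewrite -cks -(subn0 i); case: ifP => [_|lst].
  by rewrite -{1}(cats0 (pairmap _ _ _)) subn0 -{1}(subn0 i) reshape_index_pairmap.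
rewrite -cats1 reshape_index_pairmap ?subn0 //.
rewrite /reshape_index /= ifT // subn_eq0 ltn_sub2r //.
have : last 0 ks <= n.+1.
  have := mem_last 0 ks; rewrite inE => /orP[/eqP-> //|/mapP[k _ ->]]; exact: ltn_ord.
by rewrite leq_eqVlt lst.
Qed.

(** A new block begins just after each element of K. *)
Lemma same_block_type_of (n : nat) (K : {set 'I_n.+1}) (i j : 'I_n.+1) : i <= j ->
  same_block (type_of K) i j = [forall k in K, ~~ (i <= k < j)].
Proof.
move=> ij; rewrite /same_block !reshape_index_type_of.
have sub : ([set k in K | k < i] \subset [set k in K | k < j])%SET.
  apply/fintype.subsetP => k; rewrite !inE => /andP[-> ki] /=.
  exact: leq_trans ki ij.
rewrite (subset_leqif_cards sub); apply/eqP/forall_inP => [E k kK|H].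
  have /setP/(_ k) := E; rewrite !inE kK /= => <-.
  by rewrite leqNgt andNb.
apply/setP => k; rewrite !inE; have [kK|//] := boolP (k \in K) => /=.
apply/idP/idP => [ki|kj]; first exact: leq_trans ki ij.
by have := H k kK; rewrite negb_and -ltnNge kj orbF.
Qed.

End TypeOf.

(** * Flags as symmetric matrices *)

Section Grading.
Context {R : realType} {n : nat}.
Implicit Types (I : seq nat) (U V Q A B C : 'M[R]_n.+1).

(** Its eigenspaces are the blocks of I, so that the matrices commuting with it
    are the block-diagonal ones. *)
Definition grading I : 'M[R]_n.+1 :=
  diag_mx (\row_i (reshape_index I i)%:R).

Definition grade_gap I (i j : 'I_n.+1) : R :=
  (reshape_index I j)%:R - (reshape_index I i)%:R.

Lemma grade_gap_eq0 I i j : (grade_gap I i j == 0) = same_block I i j.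
Proof. by rewrite subr_eq0 eqr_nat eq_sym. Qed.

Lemma grading_bracketE I A i j :
  (A *m grading I - grading I *m A) i j = A i j * grade_gap I i j.
Proof.
by rewrite mxE [X in _ + X]mxE mul_mx_diag mul_diag_mx !mxE mulrBr [_%:R * _]mulrC.
Qed.

Lemma grading_commP I A : A *m grading I = grading I *m A <->
  forall i j, ~~ same_block I i j -> A i j = 0.
Proof.
split=> [E i j|H].
  rewrite -grade_gap_eq0 => /negPf gap; have := grading_bracketE I A i j.
  by rewrite E subrr mxE => /esym/eqP; rewrite mulf_eq0 gap orbF => /eqP.
apply/eqP; rewrite -subr_eq0; apply/eqP/matrixP => i j.
rewrite grading_bracketE mxE; have [b|/H->] := boolP (same_block I i j).
  by move: b; rewrite -grade_gap_eq0 => /eqP->; rewrite mulr0.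
by rewrite mul0r.
Qed.

Lemma grading_tr I : (grading I)^T = grading I.
Proof. exact: tr_diag_mx. Qed.

Lemma orthogonal_mulT U : orthogonal_group U -> U *m U^T = 1%:M.
Proof. exact: mulmx1C. Qed.

Lemma orthogonalM U V :
  orthogonal_group U -> orthogonal_group V -> orthogonal_group (U *m V).
Proof.
rewrite /orthogonal_group/= => hU hV.
by rewrite trmx_mul -mulmxA [U^T *m _]mulmxA hU mul1mx.
Qed.

Lemma orthogonalT U : orthogonal_group U -> orthogonal_group U^T.
Proof. by move=> hU; rewrite /orthogonal_group/= trmxK; exact: orthogonal_mulT. Qed.

Lemma orthogonal_mulK U A : orthogonal_group U -> U^T *m (U *m A) = A.
Proof. by rewrite mulmxA => ->; rewrite mul1mx. Qed.

Lemma orthogonal_mulVK U A : orthogonal_group U -> U *m (U^T *m A) = A.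
Proof. by move=> /orthogonal_mulT hU; rewrite mulmxA hU mul1mx. Qed.

Lemma block_orthogonalP I Q : block_orthogonal I Q <->
  orthogonal_group Q /\ Q *m grading I = grading I *m Q.
Proof.
by split=> -[hQ /(grading_commP I Q) bQ].
Qed.

(** The point U O(I) of the flag manifold is encoded by the symmetric matrix
    U D U^T, where D is diagonal with one eigenvalue for each block: this is
    the embedding of the flag manifold as an orbit of symmetric matrices. *)
Definition flag_mx I U : 'M[R]_n.+1 := U *m grading I *m U^T.

Lemma flag_mx_mul_block I U Q : block_orthogonal I Q ->
  flag_mx I (U *m Q) = flag_mx I U.
Proof.
move=> /(block_orthogonalP I Q).1[hQ cQ]; rewrite /flag_mx trmx_mul !mulmxA.
by rewrite -(mulmxA U Q) cQ -!mulmxA [Q *m (Q^T *m _)]orthogonal_mulVK.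
Qed.

Lemma block_orthogonalM I Q Q' : block_orthogonal I Q -> block_orthogonal I Q' ->
  block_orthogonal I (Q *m Q').
Proof.
move=> /(block_orthogonalP I Q).1[hQ cQ] /(block_orthogonalP I Q').1[hQ' cQ'].
apply/block_orthogonalP; split; first exact: orthogonalM.
by rewrite -mulmxA cQ' mulmxA cQ mulmxA.
Qed.

Lemma block_orthogonal1 I : block_orthogonal I (1%:M : 'M[R]_n.+1).
Proof.
by apply/block_orthogonalP; split;
  rewrite ?mulmx1 ?mul1mx // /orthogonal_group/= trmx1 mul1mx.
Qed.

Lemma flag_proj_self I U : flag_proj I U U.
Proof. by exists 1%:M; rewrite ?mulmx1 //; exact: block_orthogonal1. Qed.

Lemma flag_proj_eqP I U V : orthogonal_group U -> orthogonal_group V ->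
  flag_proj I U = flag_proj I V <-> flag_mx I U = flag_mx I V.
Proof.
move=> hU hV; split=> [E|E].
  have : flag_proj I U V by rewrite E; exact: flag_proj_self.
  by case=> Q bQ <-; rewrite flag_mx_mul_block.
have half A B : orthogonal_group A -> orthogonal_group B ->
    flag_mx I A = flag_mx I B -> flag_proj I A `<=` flag_proj I B.
  move=> hA hB; rewrite /flag_mx => e _ [Q /(block_orthogonalP I Q).1[hQ cQ] <-].
  exists (B^T *m A *m Q); last by rewrite -mulmxA orthogonal_mulVK.
  apply/block_orthogonalP; split.
    by apply: orthogonalM => //; apply: orthogonalM => //; exact: orthogonalT.
  have e' : A *m grading I = B *m grading I *m B^T *m A.
    by rewrite -e -!mulmxA hA mulmx1.
  by rewrite -mulmxA cQ mulmxA -(mulmxA B^T A) e' !mulmxA hB mul1mx.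
by rewrite eqEsubset; split; apply: half.
Qed.

End Grading.

(** * Sums with weights that are constant on blocks *)

Section WeightedSums.
Context {R : realType} {n : nat}.
Implicit Types (I : seq nat) (Q A B C : 'M[R]_n.+1) (w : 'I_n.+1 -> 'I_n.+1 -> R).

Definition upper_sum w B C : R :=
  \sum_(i < n.+1) \sum_(j < n.+1 | (i < j)%N) w i j * B i j * C i j.

Definition block_constant I w :=
  forall i i' j j', same_block I i i' -> same_block I j j' -> w i j = w i' j'.

Lemma skewE B i j : Defs.skew B -> B i j = - B j i.
Proof. by move=> /matrixP/(_ j i); rewrite !mxE. Qed.

Lemma skew_diag B i : Defs.skew B -> B i i = 0.
Proof.
by move=> /(@skewE B i i)/eqP; rewrite -addr_eq0 -mulr2n mulrn_eq0/= => /eqP.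
Qed.

(** The signs of the two skew-symmetric matrices cancel, so that the summand is
    symmetric in i and j.  The trace form on the right is the one on which
    conjugations act. *)
Lemma upper_sum_double w B C : (forall i j, w i j = w j i) -> Defs.skew B -> Defs.skew C ->
  (upper_sum w B C) *+ 2 = \tr ((\matrix_(i, j) (w i j * B i j))^T *m C).
Proof.
move=> sw sB sC; pose F i j := w i j * B i j * C i j.
have -> : \tr ((\matrix_(i, j) (w i j * B i j))^T *m C) = \sum_i \sum_j F i j.
  rewrite /mxtrace exchange_big/=; apply: eq_bigr => i _; rewrite mxE.
  by apply: eq_bigr => j _; rewrite !mxE.
have split_row i : \sum_j F i j =
    \sum_(j < n.+1 | (i < j)%N) F i j + \sum_(j < n.+1 | (j < i)%N) F i j.
  rewrite (bigID (fun j : 'I_n.+1 => (i < j)%N))/=; congr (_ + _).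
  rewrite (bigD1 i) /=; last by rewrite ltnn.
  rewrite /F skew_diag // mulr0 mul0r add0r; apply: eq_bigl => j.
  by rewrite -leqNgt ltn_neqAle andbC.
under [RHS]eq_bigr do rewrite split_row.
rewrite big_split /= mulr2n; congr (_ + _).
rewrite (exchange_big_dep xpredT)//=; apply: eq_bigr => i _.
apply: eq_bigr => j _.
by rewrite /F sw (skewE _ _ sB) (skewE _ _ sC) !mulrN mulNr opprK.
Qed.

(** In the (i, j) entry of Q^T B Q only entries of B in the same pair of blocks
    occur, and they all carry the weight of (i, j). *)
Lemma block_congr_weight I w Q B : block_constant I w -> block_orthogonal I Q ->
  \matrix_(i, j) (w i j * (Q^T *m B *m Q) i j) =
  Q^T *m (\matrix_(i, j) (w i j * B i j)) *m Q.
Proof.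
move=> cw [_ bQ]; apply/matrixP => i j; rewrite !mxE mulr_sumr.
apply: eq_bigr => l _; rewrite !mxE mulrA; have [lj|/bQ->] := boolP (same_block I l j); last first.
  by rewrite !mulr0.
congr (_ * _); rewrite mulr_sumr; apply: eq_bigr => k _; rewrite !mxE.
have [ki|/bQ->] := boolP (same_block I k i); last by rewrite !mul0r mulr0.
by rewrite (cw k i l j) // mulrCA.
Qed.

Lemma upper_sum_block_congr I w Q B C : (forall i j, w i j = w j i) ->
  block_constant I w -> block_orthogonal I Q -> Defs.skew B -> Defs.skew C ->
  upper_sum w (Q^T *m B *m Q) (Q^T *m C *m Q) = upper_sum w B C.
Proof.
move=> sw cw bQ sB sC; have [hQ _] := bQ.
have skewJ A : Defs.skew A -> Defs.skew (Q^T *m A *m Q).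
  by move=> sA; rewrite /Defs.skew/= !trmx_mul trmxK sA mulNmx mulmxN mulmxA.
apply: (@mulIf _ (2 : R)); first by rewrite pnatr_eq0.
rewrite !mulr_natr !upper_sum_double //; [|exact: skewJ..].
rewrite (block_congr_weight _ cw bQ) !trmx_mul trmxK -!mulmxA.
by rewrite orthogonal_mulVK // mxtrace_mulC -!mulmxA orthogonal_mulT // mulmx1.
Qed.

End WeightedSums.

Section Windows.
Context {R : realType} {n : nat}.
Implicit Types (K : {set 'I_n.+1}) (mu : 'rV[R]_n.+1).

Lemma same_block_sym I i j : @same_block n I i j = same_block I j i.
Proof. by rewrite /same_block eq_sym. Qed.

Lemma same_block_geq K (i j l : 'I_n.+1) : l \in K ->
  same_block (type_of K) i j -> (i <= l)%N = (j <= l)%N.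
Proof.
move=> lK; wlog ij : i j / (i <= j)%N => [H|].
  by case: (leqP i j) => [/H//|/ltnW/H{}H]; rewrite same_block_sym => /H.
rewrite same_block_type_of // => /forall_inP/(_ l lK).
rewrite negb_and -ltnNge -leqNgt => H; apply/idP/idP; last exact: leq_trans.
by move=> il; case/orP: H => //; rewrite ltnNge il.
Qed.

Lemma window_geq mu (i j : 'I_n.+1) : (j <= i)%N -> window mu i j = 0.
Proof.
move=> ji; apply/rowP => l; rewrite !mxE; case: ifP => // /andP[il lj].
by have := leq_ltn_trans il lj; rewrite ltnNge ji.
Qed.

Lemma window_eq0 K mu (i j : 'I_n.+1) : open_simplex K mu -> (i <= j)%N ->
  window mu i j = 0 <-> same_block (type_of K) i j.
Proof.
move=> [_ muK] ij; rewrite same_block_type_of //; split.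
  move=> /rowP w0; apply/forall_inP => l lK; apply/negP => ilj.
  by have := w0 l; rewrite !mxE ilj => E; have := (muK l).1 lK; rewrite E ltxx.
move=> /forall_inP H; apply/rowP => l; rewrite !mxE.
have [/H/negPf->//|/((muK l).2)->] := boolP (l \in K); exact: if_same.
Qed.

(** At most one of the two windows is nonzero, so that the sum is a way of
    writing the window of an unordered pair of indices. *)
Definition window_weight (f : 'rV[R]_n.+1 -> R) mu (i j : 'I_n.+1) : R :=
  f (window mu i j + window mu j i) ^+ 2.

Lemma window_weight_sym f mu i j : window_weight f mu i j = window_weight f mu j i.
Proof. by rewrite /window_weight addrC. Qed.

Lemma window_weight_block_constant f K mu : open_simplex K mu ->
  block_constant (type_of K) (window_weight f mu).
Proof.
move=> [_ muK] i i' j j' ii jj; rewrite /window_weight; congr (f _ ^+ 2).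
apply/rowP => l; rewrite !mxE; have [lK|/((muK l).2)->] := boolP (l \in K).
  by rewrite !(ltnNge l) (same_block_geq lK ii) (same_block_geq lK jj).
by rewrite !if_same.
Qed.

Lemma metric_formula_weight f mu alpha beta (B C : 'M[R]_n.+1) :
  metric_formula f mu alpha beta B C =
  \sum_i alpha 0 i * beta 0 i + upper_sum (window_weight f mu) B C.
Proof.
congr (_ + _); apply: eq_bigr => i _; apply: eq_bigr => j ij.
by rewrite /window_weight (@window_geq mu j i) ?addr0 // ltnW.
Qed.

End Windows.

(** * Cayley curves of orthogonal matrices *)

Section CvgMatrixOps.
Context {R : realType} {T : Type} (F : set_system T) {FF : Filter F}.

Lemma cvg_mx_coord m n (M : T -> 'M[R]_(m, n)) (l : 'M[R]_(m, n)) i j :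
  M @ F --> l -> (fun t => M t i j) @ F --> l i j.
Proof.
move=> Ml; apply: (cvg_comp M (fun A : 'M[R]_(m, n) => A i j) Ml).
exact: coord_continuous.
Qed.

Lemma cvg_mulmx m n p (A : T -> 'M[R]_(m, n)) (B : T -> 'M[R]_(n, p))
    (a : 'M[R]_(m, n)) (b : 'M[R]_(n, p)) :
  A @ F --> a -> B @ F --> b -> (fun t => A t *m B t) @ F --> a *m b.
Proof.
move=> Aa Bb; apply: cvg_mx => i j; rewrite mxE.
rewrite (_ : (fun t => _) = fun t => \sum_k A t i k * B t k j); last first.
  by apply/funext => t; rewrite mxE.
by apply: cvg_sum_seq => k _; apply: cvgM; exact: cvg_mx_coord.
Qed.

End CvgMatrixOps.

Section CkMatrixOps.
Context {R : realType} {V : normedModType R}.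
Implicit Types (O : set V).

Lemma Ck_open_mulmx k O m n p (A : V -> 'M[R]_(m, n)) (B : V -> 'M[R]_(n, p)) :
  open O -> Ck_open k O A -> Ck_open k O B -> Ck_open k O (fun x => A x *m B x).
Proof.
move=> oO /(Ck_open_mxP k _ oO) HA /(Ck_open_mxP k _ oO) HB.
apply/(Ck_open_mxP k _ oO) => i j.
apply: (Ck_open_ext oO (h := fun x => \sum_l A x i l * B x l j)).
  by move=> x _; rewrite mxE.
by apply: Ck_open_sum => // l _; exact: Ck_openM.
Qed.

Lemma Ck_open_det k O n (A : V -> 'M[R]_n) : open O ->
  (forall i j, Ck_open k O (fun x => A x i j)) -> Ck_open k O (fun x => \det (A x)).
Proof.
move=> oO HA; apply: Ck_open_sum => // s _.
apply: (@Ck_openM _ _ k O (fun=> (-1) ^+ perm.odd_perm s)) => //; first exact: Ck_open_cst.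
by apply: Ck_open_prod => // i; exact: HA.
Qed.

Lemma Ck_open_invmx k O n (A : V -> 'M[R]_n.+1) : open O ->
  (forall x, O x -> A x \in unitmx) ->
  Ck_open k O A -> Ck_open k O (fun x => invmx (A x)).
Proof.
move=> oO uA /(Ck_open_mxP k _ oO) HA; apply/(Ck_open_mxP k _ oO) => i j.
apply: (Ck_open_ext oO (h := fun x => (\det (A x))^-1 * cofactor (A x) j i)).
  by move=> x Ox; rewrite /invmx uA // !mxE.
apply: Ck_openM => //.
  apply: Ck_openV => //; last exact: Ck_open_det.
  by move=> x /uA; rewrite unitmxE unitfE.
apply: (@Ck_openM _ _ k O (fun=> (-1) ^+ (j + i))) => //; first exact: Ck_open_cst.
apply: Ck_open_det => // a b.
by apply: Ck_open_ext oO _ (HA (lift j a) (lift i b)) => x _; rewrite !mxE.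
Qed.

End CkMatrixOps.

Section Cayley.
Context {R : realType} {n : nat}.
Implicit Types (A B D : 'M[R]_n.+1).

Lemma row_sqnorm_eq0 m (v : 'rV[R]_m) : v *m v^T = 0 -> v = 0.
Proof.
move=> /matrixP/(_ 0 0); rewrite !mxE => /eqP.
rewrite psumr_eq0 => [/allP v0|i _]; last by rewrite mxE -expr2 sqr_ge0.
apply/rowP => i; have := v0 i (mem_index_enum i).
by rewrite !mxE -expr2 sqrf_eq0 => /eqP.
Qed.

(** If v A = v with A skew-symmetric, then v v^T = v A v^T = 0. *)
Lemma unit_one_sub_skew A : Defs.skew A -> 1%:M - A \in unitmx.
Proof.
move=> sA; rewrite unitmxE unitfE; apply/det0P => -[v v0].
rewrite mulmxBr mulmx1 => /eqP; rewrite subr_eq0 => /eqP vA.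
have q0 : v *m A *m v^T = 0.
  have : (v *m A *m v^T)^T = - (v *m A *m v^T).
    by rewrite !trmx_mul trmxK sA mulNmx mulmxN mulmxA.
  move=> /matrixP/(_ 0 0); rewrite mxE [RHS]mxE => /eqP.
  rewrite -addr_eq0 -mulr2n mulrn_eq0/= => /eqP E.
  by apply/matrixP => i j; rewrite !ord1 E mxE.
by move: v0; rewrite (row_sqnorm_eq0 (v := v)) ?eqxx // {1}vA.
Qed.

(** A rational substitute for the exponential of t B; halving t makes B the
    velocity at 0. *)
Definition cayley B (t : R) : 'M[R]_n.+1 :=
  invmx (1%:M - (t / 2) *: B) *m (1%:M + (t / 2) *: B).

Lemma skewZ a B : Defs.skew B -> Defs.skew (a *: B).
Proof. by rewrite /Defs.skew/= linearZ/= => ->; rewrite scalerN. Qed.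

Lemma cayley0 B : cayley B 0 = 1%:M.
Proof. by rewrite /cayley mul0r scale0r subr0 addr0 mulmx1 invmx1. Qed.

Lemma cayley_orthogonal B t : Defs.skew B -> orthogonal_group (cayley B t).
Proof.
move=> sB; rewrite /cayley; set A := (t / 2) *: B.
have sA : A^T = - A by exact: skewZ.
have uM : 1%:M - A \in unitmx by exact: unit_one_sub_skew.
have uP : 1%:M + A \in unitmx.
  by rewrite -unitmx_tr linearD/= trmx1 sA.
have MP : (1%:M - A) *m (1%:M + A) = (1%:M + A) *m (1%:M - A).
  rewrite mulmxDr [RHS]mulmxDl mulmx1 mul1mx; congr (_ + _).
  by rewrite mulmxBl mulmxBr mul1mx mulmx1.
have VV : invmx (1%:M + A) *m invmx (1%:M - A) = invmx (1%:M - A) *m invmx (1%:M + A).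
  transitivity (((1%:M - A) * (1%:M + A))^-1); first by rewrite invrM.
  by rewrite -[_ * _]/(_ *m _) MP; exact: invrM.
have trM : (1%:M - A)^T = 1%:M + A by rewrite raddfB/= trmx1 sA opprK.
have trP : (1%:M + A)^T = 1%:M - A by rewrite raddfD/= trmx1 sA.
rewrite /orthogonal_group/= trmx_mul trmx_inv trM trP.
rewrite -mulmxA (mulmxA (invmx (1%:M + A))) VV -!mulmxA.
by rewrite mulKVmx // mulVmx.
Qed.

Lemma cayley_comm B D t : Defs.skew B -> B *m D = D *m B ->
  cayley B t *m D = D *m cayley B t.
Proof.
move=> sB BD; rewrite /cayley; set A := (t / 2) *: B.
have uM : 1%:M - A \in unitmx by apply: unit_one_sub_skew; exact: skewZ.
have AD : A *m D = D *m A by rewrite -scalemxAl BD scalemxAr.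
have PD : (1%:M + A) *m D = D *m (1%:M + A).
  by rewrite mulmxDl mulmxDr AD mul1mx mulmx1.
have MD : (1%:M - A) *m D = D *m (1%:M - A).
  by rewrite mulmxBl mulmxBr AD mul1mx mulmx1.
rewrite -mulmxA PD !mulmxA; congr (_ *m _).
by rewrite -[in LHS](mulmxK uM D) -MD -mulmxA mulKmx.
Qed.

Lemma cayley_Ck k B : Defs.skew B -> Ck_open k setT (cayley B).
Proof.
move=> sB.
have HA (a : R) : Ck_open k setT (fun t : R => 1%:M + (t * a) *: B).
  apply/(Ck_open_mxP k _ openT) => i j.
  apply: (Ck_open_ext openT (h := (cst ((1%:M : 'M[R]_n.+1) i j)) \+
     ((id \* cst a) \* cst (B i j)))); first by move=> t _; rewrite !mxE.
  apply: Ck_openD; [exact: openT|exact: Ck_open_cst|].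
  apply: Ck_openM; [exact: openT| |exact: Ck_open_cst].
  apply: Ck_openM; [exact: openT|exact: Ck_open_id|exact: Ck_open_cst].
apply: Ck_open_mulmx; [exact: openT| |exact: HA].
apply: Ck_open_invmx; first exact: openT.
  by move=> t _; apply: unit_one_sub_skew; exact: skewZ.
apply: (Ck_open_ext openT _ (HA (- 2^-1))) => t _.
by rewrite mulrN scaleNr.
Qed.

(** By its definition the curve satisfies
    cayley B t - 1 = (t / 2) B (cayley B t + 1). *)
Lemma is_derive_cayley0 B : Defs.skew B -> is_derive (0 : R) 1 (cayley B) B.
Proof.
move=> sB; have [cc dc] := cayley_Ck 1 sB.
apply/is_derive_slope0P.
have c0 : cayley B @ 0^' --> (1%:M : 'M[R]_n.+1).
  rewrite -(cayley0 B); apply: cvg_trans (cc 0 I).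
  by apply: cvg_app; exact: nbhs_dnbhs.
have E t : cayley B t - 1%:M = t *: (2^-1 *: (B *m (cayley B t + 1%:M))).
  have uM : 1%:M - (t / 2) *: B \in unitmx by apply: unit_one_sub_skew; exact: skewZ.
  have : (1%:M - (t / 2) *: B) *m cayley B t = 1%:M + (t / 2) *: B.
    by rewrite mulKVmx.
  rewrite mulmxBl mul1mx => /eqP; rewrite subr_eq => /eqP e.
  rewrite {1}e addrAC -addrA addrA [1%:M + _]addrC addrK -scalemxAl -scalerDr.
  by rewrite scalerA mulmxDr mulmx1 addrC.
have L : (fun t => 2^-1 *: (B *m (cayley B t + 1%:M))) @ 0^' --> B.
  rewrite [X in _ --> X](_ : B = 2^-1 *: (B *m (1%:M + 1%:M))); last first.
    by rewrite mulmxDr mulmx1 -mulr2n -[B *+ 2]scaler_nat scalerA mulVf ?scale1r ?pnatr_eq0.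
  apply: cvgZl_tmp; apply: cvg_mulmx; first exact: cvg_cst.
  by apply: cvgD => //; exact: cvg_cst.
apply: near_cvg L; near=> t.
rewrite cayley0 E scalerA mulVf ?scale1r//.
by near: t; exact: nbhs_dnbhs_neq.
Unshelve. all: by end_near. Qed.

End Cayley.

(** * The frame of a flag closest to a given one *)

Section ClosestFrame.
Context {R : realType} {n : nat}.
Implicit Types (I : seq nat) (G H Q A B D : 'M[R]_n.+1).

Lemma orthogonal_entry_le1 Q i j : orthogonal_group Q -> `|Q i j| <= 1.
Proof.
move=> /matrixP/(_ j j); rewrite !mxE eqxx mulr1n (bigD1 i)//= mxE => E.
rewrite -(@expr_le1 _ 2) // real_normK ?num_real // -E -expr2 lerDl.
by apply: sumr_ge0 => k _; rewrite mxE -expr2 sqr_ge0.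
Qed.

Lemma compact_block_orthogonal I :
  compact [set v : 'rV[R]_(n.+1 * n.+1) | block_orthogonal I (vec_mx v)].
Proof.
apply: bounded_closed_compact.
  exists 1; split; first exact: real1.
  move=> M M1 v [ov _]; apply: le_trans (ltW M1).
  rewrite /Num.Def.normr/= mx_normrE (bigmax_le _ ler01)//= => -[i k] _ /=.
  rewrite ord1; case/mxvec_indexP: k => i' j'.
  by have := orthogonal_entry_le1 i' j' ov; rewrite mxE.
(* The sum of the squares of the defects of all the defining equations, so
   that the set is the zero set of one continuous function. *)
pose phi (v : 'rV[R]_(n.+1 * n.+1)) : R :=
  \sum_(p : 'I_n.+1 * 'I_n.+1)
    ((\sum_k v 0 (mxvec_index k p.1) * v 0 (mxvec_index k p.2) - (p.1 == p.2)%:R) ^+ 2 +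
     (~~ same_block I p.1 p.2)%:R * v 0 (mxvec_index p.1 p.2) ^+ 2).
have cphi : continuous phi.
  have cv i j : Ck_open 0 setT (fun v : 'rV[R]_(n.+1 * n.+1) => v 0 (mxvec_index i j)).
    exact: Ck_open_coord openT.
  have H : Ck_open 0 setT phi.
    rewrite /phi; apply: Ck_open_sum => [|p _]; first exact: openT.
    apply: Ck_openD; first exact: openT.
      have cs : Ck_open 0 setT (fun v : 'rV[R]_(n.+1 * n.+1) =>
         \sum_k v 0 (mxvec_index k p.1) * v 0 (mxvec_index k p.2) - (p.1 == p.2)%:R).
        apply: Ck_openD; [exact: openT| |exact: Ck_open_cst].
        apply: Ck_open_sum => [|k _]; first exact: openT.
        by apply: Ck_openM; first exact: openT.
      by apply: Ck_openM; first exact: openT.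
    apply: Ck_openM; [exact: openT|exact: Ck_open_cst|].
    by apply: Ck_openM; first exact: openT.
  by move=> v; case: H => /(_ v Logic.I).
rewrite (_ : mkset _ = phi @^-1` [set 0]).
  by apply: closed_comp => [v _|]; [exact: cphi|exact: closed_eq].
apply/seteqP; split => v /=.
  move=> [ov bv]; rewrite /phi big1 // => -[i j] _ /=.
  have -> : \sum_k v 0 (mxvec_index k i) * v 0 (mxvec_index k j) = (i == j)%:R.
    have /matrixP/(_ i j) := ov; rewrite !mxE => <-.
    by apply: eq_bigr => k _; rewrite !mxE.
  rewrite subrr expr0n add0r.
  have [_|/bv] := boolP (same_block I i j); first by rewrite mul0r.
  by rewrite mxE => ->; rewrite expr0n mulr0.
move=> /eqP; rewrite /phi psumr_eq0; last first.
  by move=> p _; rewrite addr_ge0 ?sqr_ge0 // mulr_ge0 ?sqr_ge0.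
move=> /allP H; have {}H i j := H (i, j) (mem_index_enum _).
split.
  apply/matrixP => i j; move: (H i j) => /=.
  rewrite paddr_eq0; [|exact: sqr_ge0|by rewrite mulr_ge0 ?sqr_ge0]; rewrite sqrf_eq0 subr_eq0 => /andP[/eqP E _].
  by rewrite !mxE -E; apply: eq_bigr => k _; rewrite !mxE.
move=> i j nij; move: (H i j) => /=.
rewrite paddr_eq0; [|exact: sqr_ge0|by rewrite mulr_ge0 ?sqr_ge0]; rewrite nij mul1r => /andP[_].
by rewrite sqrf_eq0 mxE => /eqP.
Qed.

(** A matrix of O(I) maximizing this trace is one minimizing the distance
    between its transpose and G. *)
Lemma block_orthogonal_trace_max I G : exists2 Q, block_orthogonal I Q &
  forall Q', block_orthogonal I Q' -> \tr (G *m Q') <= \tr (G *m Q).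
Proof.
pose A := [set v : 'rV[R]_(n.+1 * n.+1) | block_orthogonal I (vec_mx v)].
pose psi (v : 'rV[R]_(n.+1 * n.+1)) : R := \tr (G *m vec_mx v).
have [||v] := @EVT_max_rV R _ psi A _ (@compact_block_orthogonal I).
- by exists (mxvec 1%:M); rewrite /A/= mxvecK; exact: block_orthogonal1.
- apply: continuous_subspaceT => v.
  have : Ck_open 0 setT psi.
    rewrite /psi /mxtrace; apply: Ck_open_sum => [|i _]; first exact: openT.
    apply: (Ck_open_ext openT (h := fun v : 'rV[R]_(n.+1 * n.+1) =>
       \sum_k G i k * v 0 (mxvec_index k i))).
      by move=> w _; rewrite mxE; apply: eq_bigr => k _; rewrite mxE.
    apply: Ck_open_sum => [|k _]; first exact: openT.
    by apply: (@Ck_openM _ _ 0 _ (fun=> G i k)); [exact: openT|exact: Ck_open_cst|exact: Ck_open_coord openT].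
  by case => /(_ v Logic.I).
rewrite inE => Av H; exists (vec_mx v) => // Q' bQ'.
by have := H (mxvec Q'); rewrite inE /A /= /psi mxvecK; apply.
Qed.

End ClosestFrame.

Section Reflection.
Context {R : realType} {n : nat}.
Implicit Types (I : seq nat) (G H Q A B D : 'M[R]_n.+1) (y : 'cV[R]_n.+1).

Lemma colmx_sq y : y^T *m y = (\sum_i y i 0 ^+ 2)%:M.
Proof.
rewrite [LHS]mx11_scalar mxE; congr (_%:M); apply: eq_bigr => i _.
by rewrite mxE.
Qed.

Lemma colmx_sq_gt0 y : y != 0 -> 0 < \sum_i y i 0 ^+ 2.
Proof.
move=> y0; rewrite lt_def sumr_ge0 ?andbT => [|i _]; last exact: sqr_ge0.
apply: contra y0; rewrite psumr_eq0 => [/allP y0|i _]; last exact: sqr_ge0.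
apply/eqP/matrixP => i j; rewrite ord1 mxE; apply/eqP.
by have := y0 i (mem_index_enum i); rewrite sqrf_eq0.
Qed.

Definition reflection y : 'M[R]_n.+1 :=
  1%:M - (2 / \sum_i y i 0 ^+ 2) *: (y *m y^T).

Lemma reflection_block_orthogonal I y : y != 0 ->
  (forall i j, ~~ same_block I i j -> y i 0 * y j 0 = 0) ->
  block_orthogonal I (reflection y).
Proof.
move=> /colmx_sq_gt0 s0 yI; rewrite /reflection; set s := \sum_i _ in s0 *.
have yy : (y *m y^T) *m (y *m y^T) = s *: (y *m y^T).
  by rewrite mulmxA -(mulmxA y) colmx_sq mul_mx_scalar scalemxAl.
split; last first.
  move=> i j nij; rewrite !mxE big_ord1 !mxE yI // mulr0 subr0.
  by have [E|//] := eqVneq i j; rewrite E /same_block eqxx in nij.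
set X := _ *: _; have XT : (1%:M - X)^T = 1%:M - X.
  by rewrite raddfB/= trmx1 /X linearZ/= trmx_mul trmxK.
have XX : X *m X = X + X.
  rewrite /X -scalemxAl -scalemxAr yy 2!scalerA -mulrA divfK ?gt_eqF//.
  by rewrite -scalerDl mulr_natr mulr2n.
rewrite /orthogonal_group/= XT mulmxBl mul1mx mulmxBr mulmx1 XX.
have -> : X - (X + X) = - X by rewrite opprD addrA subrr sub0r.
by rewrite opprK subrK.
Qed.

Lemma trace_mul_reflection H y :
  \tr (H *m reflection y) = \tr H - (2 / \sum_i y i 0 ^+ 2) * (y^T *m H *m y) 0 0.
Proof.
rewrite /reflection mulmxBr mulmx1 raddfB/= -scalemxAr mxtraceZ; congr (_ - _ * _).
by rewrite mulmxA mxtrace_mulC mulmxA trace_mx11.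
Qed.

End Reflection.

Section TraceMaximal.
Context {R : realType} {n : nat}.
Variables (I : seq nat) (H : 'M[R]_n.+1).
Hypothesis Hmax : forall Q, block_orthogonal I Q -> \tr (H *m Q) <= \tr H.

(** The reflection in the hyperplane orthogonal to y, which belongs to O(I)
    when y is supported in one block, subtracts from the trace a positive
    multiple of the quadratic form at y. *)
Lemma trace_max_psd (y : 'cV[R]_n.+1) :
  (forall i j, ~~ same_block I i j -> y i 0 * y j 0 = 0) ->
  0 <= (y^T *m H *m y) 0 0.
Proof.
move=> yI; have [->|y0] := eqVneq y 0; first by rewrite mulmx0 mxE.
have := Hmax (reflection_block_orthogonal y0 yI).
rewrite trace_mul_reflection lerBlDr lerDl pmulr_rge0 //.
by rewrite divr_gt0 // colmx_sq_gt0.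
Qed.

(** The rotations in the plane of two indices of a same block form a curve of
    O(I) through the identity, along which the trace is stationary. *)
Lemma trace_max_sym i j : same_block I i j -> H i j = H j i.
Proof.
move=> ij; pose S : 'M[R]_n.+1 := delta_mx i j - delta_mx j i.
have sS : Defs.skew S by rewrite /Defs.skew/= /S raddfB/= !trmx_delta opprB.
have cS : S *m grading I = grading I *m S.
  apply/grading_commP => k l nkl; rewrite !mxE.
  have [/andP[/eqP ki /eqP lj]|_] := boolP ((k == i) && (l == j)).
    by move: nkl; rewrite ki lj ij.
  have [/andP[/eqP kj /eqP li]|_] := boolP ((k == j) && (l == i)).
    by move: nkl; rewrite kj li same_block_sym ij.
  by rewrite subr0.
pose phi (t : R) := \tr (H *m cayley S t).
have dphi (t : R) : derivable phi t 1.
  have : Ck_open 1 setT phi.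
    rewrite /phi /mxtrace; apply: Ck_open_sum => [|k _]; first exact: openT.
    apply: (Ck_open_mxP 1 _ openT).1; apply: Ck_open_mulmx; first exact: openT.
      exact: Ck_open_cst.
    exact: cayley_Ck.
  by case=> _ /(_ 1)[/(_ t Logic.I)].
have phi_max (t : R) : phi t <= phi 0.
  rewrite /phi cayley0 mulmx1; apply: Hmax; apply/block_orthogonalP.
  by split; [exact: cayley_orthogonal|exact: cayley_comm].
have d0 : is_derive (0 : R) 1 phi 0.
  apply: (@derive1_at_max _ phi (-1) 1 0).
  - by rewrite (@le_trans _ _ (0 : R)) // oppr_le0 ler01.
  - by move=> t _; exact: dphi.
  - by rewrite in_itv/= oppr_lt0 !ltr01.
  - by move=> t _; exact: phi_max.
have tr_delta a b : \tr (H *m delta_mx a b) = H b a.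
  rewrite /mxtrace (bigD1 b)//= big1 ?addr0 => [|k kb].
    rewrite mxE (bigD1 a)//= big1 ?addr0 => [|l la]; first by rewrite mxE !eqxx mulr1.
    by rewrite mxE (negPf la) mulr0.
  rewrite mxE big1 // => l _; rewrite mxE (negPf kb) andbF mulr0 //.
have : is_derive (0 : R) 1 phi (\tr (H *m S)).
  apply/is_derive_slope0P; have /is_derive_slope0P cS0 := is_derive_cayley0 sS.
  have L : (fun t => \tr (H *m (t^-1 *: (cayley S t - cayley S 0)))) @ 0^' --> \tr (H *m S).
    rewrite /mxtrace; apply: cvg_sum_seq => k _; apply: cvg_mx_coord.
    by apply: cvg_mulmx => //; exact: cvg_cst.
  apply: near_cvg L; near=> t.
  by rewrite -scalemxAr mxtraceZ mulmxBr raddfB.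
case=> _ E; case: d0 => _; rewrite E /S mulmxBr raddfB/= !tr_delta => /eqP.
by rewrite subr_eq0 => /eqP.
Unshelve. all: by end_near. Qed.

End TraceMaximal.

Section ClosestFrameBound.
Context {R : realType} {n : nat}.
Variables (I : seq nat) (H : 'M[R]_n.+1).
Hypothesis oH : orthogonal_group H.
Hypothesis Hmax : forall Q, block_orthogonal I Q -> \tr (H *m Q) <= \tr H.

Lemma same_block_trans i j k : same_block I i j -> same_block I j k ->
  @same_block n I i k.
Proof. by rewrite /same_block => /eqP-> /eqP->. Qed.

(** Let E be the block-diagonal part of H and F = H - E.  From H^T H = 1 and the
    symmetry of E it follows that (1 + E) (1 - E) is the block-diagonal part
    of F^T F.  As E is positive semi-definite, 1 + E does not decrease
    lengths; so the columns of 1 - E are bounded by those of F^T F. *)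
Lemma trace_max_close (rho : R) : 0 <= rho ->
  (forall i j, ~~ same_block I i j -> `|H i j| <= rho) ->
  forall i j, same_block I i j ->
    `|H i j - (i == j)%:R| <= n.+1%:R ^+ 2 * rho ^+ 2.
Proof.
move=> rho0 Hrho i j sij.
pose E a b : R := if same_block I a b then H a b else 0.
(* The j-th columns of 1 - E and of (1 + E) (1 - E). *)
pose y a : R := (a == j)%:R - E a j.
pose z a : R := y a + \sum_k E a k * y k.
have y_supp a : ~~ same_block I a j -> y a = 0.
  move=> naj; rewrite /y /E (negPf naj) subr0.
  by have [aj|//] := eqVneq a j; rewrite aj /same_block eqxx in naj.
have zE a : z a = (a == j)%:R - \sum_k E a k * E k j.
  rewrite /z /y; under eq_bigr do rewrite mulrBr.
  rewrite sumrB (bigD1 j)//= eqxx mulr1 [X in _ + X - _]big1 ?addr0 => [|k kj].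
    by rewrite addrA subrK.
  by rewrite (negPf kj) mulr0.
have z_le a : `|z a| <= n.+1%:R * rho ^+ 2.
  rewrite zE; have [saj|naj] := boolP (same_block I a j); last first.
    have -> : (a == j) = false.
      by have [aj|//] := eqVneq a j; rewrite aj /same_block eqxx in naj.
    rewrite big1 ?subr0 ?normr0 => [|k _]; first by rewrite mulr_ge0 ?sqr_ge0.
    rewrite /E; case: ifP => [sak|]; last by rewrite mul0r.
    case: ifP => [skj|]; last by rewrite mulr0.
    by rewrite (same_block_trans sak skj) in naj.
  have -> : (a == j)%:R = \sum_k H k a * H k j.
    have /matrixP/(_ a j) := oH; rewrite !mxE => <-.
    by apply: eq_bigr => k _; rewrite mxE.
  rewrite -sumrB; apply: le_trans (ler_norm_sum _ _ _) _.
  apply: (@le_trans _ _ (\sum_(k < n.+1) rho ^+ 2)); last first.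
    by rewrite sumr_const card_ord mulr_natl.
  apply: ler_sum => k _; rewrite /E.
  have [skj|nkj] := boolP (same_block I k j).
    have sak : same_block I a k.
      by rewrite same_block_sym in skj; exact: same_block_trans skj.
    by rewrite sak (trace_max_sym Hmax sak) subrr normr0 sqr_ge0.
  rewrite mulr0 subr0 normrM expr2 ler_pM // Hrho //.
  apply: contra nkj => ska; exact: same_block_trans saj.
have yEy : 0 <= \sum_a y a * \sum_k E a k * y k.
  have := @trace_max_psd _ _ _ _ Hmax (\col_a y a).
  rewrite -mulmxA mxE => psd; apply: le_trans (psd _) _.
    move=> a b nab; rewrite !mxE.
    have [saj|/y_supp->] := boolP (same_block I a j); last by rewrite mul0r.
    have [sbj|/y_supp->] := boolP (same_block I b j); last by rewrite mulr0.
    rewrite same_block_sym in sbj.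
    by rewrite (same_block_trans saj sbj) in nab.
  rewrite le_eqVlt; apply/orP; left; apply/eqP; apply: eq_bigr => a _; rewrite !mxE.
  have [saj|/y_supp->] := boolP (same_block I a j); last by rewrite !mul0r.
  congr (_ * _); apply: eq_bigr => k _; rewrite mxE.
  have [skj|/y_supp->] := boolP (same_block I k j); last by rewrite !mulr0.
  by rewrite same_block_sym in skj; rewrite /E (same_block_trans saj skj).
have y_le_z : \sum_a y a ^+ 2 <= \sum_a z a ^+ 2.
  rewrite -subr_ge0 -sumrB.
  have -> : \sum_a (z a ^+ 2 - y a ^+ 2) =
      (\sum_a y a * \sum_k E a k * y k) *+ 2 + \sum_a (\sum_k E a k * y k) ^+ 2.
    rewrite -sumrMnl -big_split /=; apply: eq_bigr => a _.
    by rewrite /z sqrrD; ring.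
  by rewrite addr_ge0 ?mulrn_wge0 // sumr_ge0 // => a _; rewrite sqr_ge0.
have -> : H i j - (i == j)%:R = - y i by rewrite /y /E sij opprB.
rewrite normrN -ler_sqr ?nnegrE ?mulr_ge0 ?sqr_ge0 // real_normK ?num_real //.
apply: (@le_trans _ _ (\sum_a y a ^+ 2)).
  by rewrite (bigD1 i)//= lerDl sumr_ge0 // => a _; rewrite sqr_ge0.
apply: le_trans y_le_z _.
apply: (@le_trans _ _ (\sum_(a < n.+1) (n.+1%:R * rho ^+ 2) ^+ 2)).
  apply: ler_sum => a _; rewrite -[z a ^+ 2]real_normK ?num_real //.
  by rewrite ler_sqr ?nnegrE ?mulr_ge0 ?sqr_ge0.
rewrite sumr_const card_ord -[leLHS]mulr_natl.
rewrite [leRHS](_ : _ = n.+1%:R ^+ 2 * (n.+1%:R * rho ^+ 2) ^+ 2); last by ring.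
rewrite ler_wpM2r ?sqr_ge0 // expr2 ler_peMl // ler1n //.
Qed.

End ClosestFrameBound.

(** * Differentiable lifts of curves of flags *)

Section FlagLift.
Context {R : realType} {n : nat}.
Implicit Types (I : seq nat) (U Q : 'M[R]_n.+1).

Lemma tr_flag_mx I U : (flag_mx I U)^T = flag_mx I U.
Proof. by rewrite /flag_mx !trmx_mul trmxK grading_tr mulmxA. Qed.

(** The coefficients of the inverse of B -> [B, D], defined on the matrices
    whose diagonal blocks vanish. *)
Definition inv_gap I (i j : 'I_n.+1) : R :=
  if same_block I i j then 0 else (grade_gap I i j)^-1.

(** The lift is the frame closest to U in each flag.  The off-diagonal blocks
    of H = U^T Lf solve [H, D] = (U^T P U - D) H, where P is the matrix of the
    flag, hence they are differentiable at 0; the diagonal blocks of H - 1 are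
    quadratic in them. *)
Lemma flag_lift I U (V : R -> 'M[R]_n.+1) (P' : 'M[R]_n.+1) :
  orthogonal_group U -> (forall t, orthogonal_group (V t)) ->
  flag_mx I (V 0) = flag_mx I U ->
  is_derive (0 : R) 1 (fun t => flag_mx I (V t)) P' ->
  exists Lf : R -> 'M[R]_n.+1, [/\ forall t, orthogonal_group (Lf t),
    forall t, flag_mx I (Lf t) = flag_mx I (V t), Lf 0 = U &
    exists2 B, horizontal_space I B & is_derive (0 : R) 1 Lf (U *m B)].
Proof.
move=> hU hV V0 /is_derive_slope0P dP.
pose Q t := s2val (cid2 (block_orthogonal_trace_max I (U^T *m V t))).
have bQ t : block_orthogonal I (Q t) by exact: (s2valP (cid2 _)).
have Qmax t Q' : block_orthogonal I Q' ->
    \tr (U^T *m V t *m Q') <= \tr (U^T *m V t *m Q t).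
  exact: (s2valP' (cid2 (block_orthogonal_trace_max I (U^T *m V t)))).
have [H HE] : {H : R -> 'M[R]_n.+1 | forall t, H t = U^T *m V t *m Q t}.
  by exists (fun t => U^T *m V t *m Q t).
have oH t : orthogonal_group (H t).
  rewrite HE; apply: orthogonalM; last by have [] := bQ t.
  by apply: orthogonalM => //; exact: orthogonalT.
have Hmax t Q' : block_orthogonal I Q' -> \tr (H t *m Q') <= \tr (H t).
  move=> bQ'; rewrite HE -mulmxA; apply: Qmax.
  exact: block_orthogonalM.
have UH t : U *m H t = V t *m Q t by rewrite HE -mulmxA orthogonal_mulVK.
pose D := grading I : 'M[R]_n.+1.
pose Del t := U^T *m (flag_mx I (V t) - flag_mx I (V 0)) *m U.
have DelE t : Del t *m H t = H t *m D - D *m H t.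
  rewrite /Del mulmxBr mulmxBl mulmxBl V0; congr (_ - _); last first.
    by rewrite /flag_mx !mulmxA hU mul1mx -(mulmxA _ U^T) hU mulmx1.
  rewrite -(flag_mx_mul_block (V t) (bQ t)) -UH /flag_mx trmx_mul.
  rewrite !mulmxA hU mul1mx -(mulmxA _ U^T) hU mulmx1 -(mulmxA _ _ (H t)) oH mulmx1 //.
pose u i j t := inv_gap I i j * (Del t *m H t) i j.
have uE i j t : ~~ same_block I i j -> H t i j = u i j t.
  move=> nij; rewrite /u DelE grading_bracketE /inv_gap (negPf nij) mulrCA mulVf ?mulr1//.
  by rewrite grade_gap_eq0.
pose rho t := \sum_(p : 'I_n.+1 * 'I_n.+1) `|u p.1 p.2 t|.
have rho0 t : 0 <= rho t by apply: sumr_ge0.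
have Hrho t i j : ~~ same_block I i j -> `|H t i j| <= rho t.
  by move=> nij; rewrite uE // /rho (bigD1 (i, j))//= lerDl sumr_ge0.
have close t := trace_max_close (oH t) (@Hmax t) (rho0 t) (Hrho t).
pose S := U^T *m P' *m U.
have sD : (fun t => t^-1 *: Del t) @ 0^' --> S.
  have L : (fun t => U^T *m (t^-1 *: (flag_mx I (V t) - flag_mx I (V 0))) *m U) @ 0^' --> S.
    by apply: cvg_mulmx; [apply: cvg_mulmx => //|]; exact: cvg_cst.
  by apply: near_cvg L; near=> t; rewrite -scalemxAr -scalemxAl.
have Del0 : Del @ 0^' --> (0 : 'M[R]_n.+1).
  have L : (fun t : R => t *: (t^-1 *: Del t)) @ 0^' --> (0 : R) *: S.
    by apply: cvgZ => //; exact: nbhs_dnbhs.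
  rewrite scale0r in L; apply: near_cvg L; near=> t.
  by rewrite scalerA mulfV ?scale1r //; near: t; exact: nbhs_dnbhs_neq.
have mulH_bounded (A : R -> 'M[R]_n.+1) : A @ 0^' --> (0 : 'M[R]_n.+1) ->
    (fun t => A t *m H t) @ 0^' --> (0 : 'M[R]_n.+1).
  move=> A0; apply: cvg_mx => i j; rewrite mxE.
  have bound t : `|(A t *m H t) i j| <= \sum_k `|A t i k|.
    rewrite mxE; apply: le_trans (ler_norm_sum _ _ _) _; apply: ler_sum => k _.
    by rewrite normrM ler_piMr // orthogonal_entry_le1.
  have s0 : (fun t => \sum_k `|A t i k|) @ 0^' --> (0 : R).
    rewrite [X in _ --> X](_ : 0 = \sum_(k < n.+1) `|0 : R|); last first.
      by rewrite big1 // => k _; rewrite normr0.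
    apply: cvg_sum_seq => k _; apply: cvg_norm.
    have L : (fun t => A t i k) @ 0^' --> (0 : 'M[R]_n.+1) i k by exact: cvg_mx_coord.
    by rewrite mxE in L.
  apply/norm_cvg0P; apply: (squeeze_cvgr _ (cvg_cst (0 : R)) s0).
  by near=> t; rewrite normr_ge0 bound.
have u0 i j : u i j @ 0^' --> (0 : R).
  have L : (fun t => (Del t *m H t) i j) @ 0^' --> (0 : 'M[R]_n.+1) i j.
    by apply: cvg_mx_coord; exact: mulH_bounded.
  rewrite mxE in L; rewrite -[X in _ --> X](mulr0 (inv_gap I i j)).
  by apply: cvgM => //; exact: cvg_cst.
have sum_norm0 (v : 'I_n.+1 -> 'I_n.+1 -> R -> R) (l : 'I_n.+1 -> 'I_n.+1 -> R) :
    (forall i j, v i j @ 0^' --> l i j) ->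
    (fun t => \sum_(p : 'I_n.+1 * 'I_n.+1) `|v p.1 p.2 t|) @ 0^' -->
       \sum_(p : 'I_n.+1 * 'I_n.+1) `|l p.1 p.2|.
  by move=> vl; apply: cvg_sum_seq => p _; apply: cvg_norm; exact: vl.
have rho_cvg : rho @ 0^' --> (0 : R).
  rewrite [X in _ --> X](_ : 0 = \sum_(p : 'I_n.+1 * 'I_n.+1) `|0 : R|); last first.
    by rewrite big1 // => p _; rewrite normr0.
  exact: (@sum_norm0 u (fun _ _ => 0 : R)).
have H1 : H @ 0^' --> (1%:M : 'M[R]_n.+1).
  apply: cvg_mx => i j; have [sij|nij] := boolP (same_block I i j); last first.
    have -> : (1%:M : 'M[R]_n.+1) i j = 0.
      rewrite mxE; have [ij|//] := eqVneq i j.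
      by rewrite ij /same_block eqxx in nij.
    by apply: near_cvg (u0 i j); near=> t; rewrite uE.
  suff L : (fun t => H t i j - (i == j)%:R) @ 0^' --> (0 : R).
    have L' : (fun t => (H t i j - (i == j)%:R) + (i == j)%:R) @ 0^' -->
        (0 + (i == j)%:R : R) by apply: cvgD => //; exact: cvg_cst.
    by rewrite add0r in L'; rewrite mxE; apply: near_cvg L'; near=> t; rewrite subrK.
  apply/norm_cvg0P.
  have b0 : (fun t => n.+1%:R ^+ 2 * rho t ^+ 2) @ 0^' --> (0 : R).
    rewrite [X in _ --> X](_ : 0 = n.+1%:R ^+ 2 * (0 * 0)); last by rewrite !mulr0.
    by apply: cvgM; [exact: cvg_cst|exact: cvgM].
  apply: (squeeze_cvgr _ (cvg_cst (0 : R)) b0).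
  by near=> t; rewrite normr_ge0 close.
have H0 : H 0 = 1%:M.
  have r0 : rho 0 = 0.
    rewrite /rho big1 // => p _.
    by rewrite /u /Del subrr mulmx0 !mul0mx mxE mulr0 normr0.
  apply/matrixP => i j; rewrite mxE; have [sij|nij] := boolP (same_block I i j).
    have := close 0 i j sij; rewrite r0 expr0n mulr0 normr_le0 subr_eq0.
    by move=> /eqP.
  have := Hrho 0 i j nij; rewrite r0 normr_le0 => /eqP ->.
  by have [ij|//] := eqVneq i j; rewrite ij /same_block eqxx in nij.
pose B := \matrix_(i, j) (inv_gap I i j * S i j).
exists (fun t => U *m H t); split.
- by move=> t; exact: orthogonalM.
- by move=> t; rewrite UH flag_mx_mul_block.
- by rewrite H0 mulmx1.
exists B.
  split; last by move=> i j sij; rewrite mxE /inv_gap sij mul0r.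
  have Ssym i j : S i j = S j i.
    have L k l : (fun t => (t^-1 *: Del t) k l) @ 0^' --> S k l by exact: cvg_mx_coord.
    rewrite -(cvg_lim (@Rhausdorff R) (L i j)) -(cvg_lim (@Rhausdorff R) (L j i)).
    suff -> : (fun t => (t^-1 *: Del t) i j) = (fun t => (t^-1 *: Del t) j i) by [].
    apply/funext => t; rewrite [LHS]mxE [RHS]mxE; congr (_ * _).
    rewrite -[in LHS](trmxK (Del t)) [LHS]mxE; congr (fun_of_matrix _ j i).
    by rewrite /Del !trmx_mul trmxK raddfB/= !tr_flag_mx mulmxA.
  rewrite /Defs.skew/=; apply/matrixP => i j.
  rewrite 2![LHS]mxE [RHS]mxE [in RHS]mxE Ssym -mulNr; congr (_ * _).
  rewrite /inv_gap same_block_sym; case: ifP => _; first by rewrite oppr0.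
  by rewrite -invrN /grade_gap opprB.
suff dH : is_derive (0 : R) 1 H B.
  apply/is_derive_slope0P; have /is_derive_slope0P dH' := dH.
  have L : (fun t => U *m (t^-1 *: (H t - H 0))) @ 0^' --> U *m B.
    by apply: cvg_mulmx => //; exact: cvg_cst.
  by apply: near_cvg L; near=> t; rewrite -scalemxAr mulmxBr.
apply/is_derive_slope0P.
have slope_u i j : (fun t => t^-1 * u i j t) @ 0^' --> B i j.
  have L : (fun t => ((t^-1 *: Del t) *m H t) i j) @ 0^' --> (S *m 1%:M) i j.
    by apply: cvg_mx_coord; exact: cvg_mulmx.
  rewrite mulmx1 in L; rewrite mxE.
  have L' : (fun t => inv_gap I i j * ((t^-1 *: Del t) *m H t) i j) @ 0^' -->
      inv_gap I i j * S i j by apply: cvgM => //; exact: cvg_cst.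
  by apply: near_cvg L'; near=> t; rewrite -scalemxAl mxE mulrCA.
apply: cvg_mx => i j; have [sij|nij] := boolP (same_block I i j); last first.
  apply: near_cvg (slope_u i j); near=> t.
  rewrite !mxE H0 mxE uE //; have [ij|_] := eqVneq i j; last by rewrite subr0.
  by rewrite ij /same_block eqxx in nij.
rewrite mxE /inv_gap sij mul0r; apply/norm_cvg0P.
have b0 : (fun t => n.+1%:R ^+ 2 * (rho t * \sum_(p : 'I_n.+1 * 'I_n.+1) `|t^-1 * u p.1 p.2 t|))
    @ 0^' --> (0 : R).
  pose l := \sum_(p : 'I_n.+1 * 'I_n.+1) `|B p.1 p.2|.
  rewrite [X in _ --> X](_ : 0 = n.+1%:R ^+ 2 * (0 * l)); last by rewrite mul0r mulr0.
  apply: cvgM; first exact: cvg_cst.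
  apply: cvgM => //.
  exact: (@sum_norm0 (fun i j t => t^-1 * u i j t) (fun i j => B i j) slope_u).
apply: (squeeze_cvgr _ (cvg_cst (0 : R)) b0); near=> t.
rewrite normr_ge0 /= !mxE H0 mxE normrM.
apply: le_trans (ler_wpM2l (normr_ge0 _) (close t i j sij)) _.
rewrite mulrCA ler_wpM2l ?sqr_ge0 // expr2 mulrCA ler_wpM2l //.
by rewrite /rho mulr_sumr; apply: ler_sum => p _; rewrite [leRHS]normrM.
Unshelve. all: by end_near. Qed.

End FlagLift.

(** * Tangent vectors and their horizontal lifts *)

Section Pushforward.
Context {R : realType} {n : nat} (I : seq nat).
Implicit Types (U Q A B xi : 'M[R]_n.+1) (X Y : smooth_fun R n I -> R)
  (h : smooth_fun R n I).

Lemma smooth_fun_extension h U : orthogonal_group U -> exists O ht,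
  [/\ open O, O U, smooth_open O ht &
      forall V, O V -> orthogonal_group V -> ht V = h (flag_proj I V)].
Proof. by case: h => h sh hU; exact: sh. Qed.

(** X is the image of xi by the tangent map of the projection at U: it maps h
    to the derivative along xi of the function h o pi, computed on any smooth
    extension of this function around U. *)
Definition pushes U xi X := forall h O ht, open O -> O U -> smooth_open O ht ->
  (forall V, O V -> orthogonal_group V -> ht V = h (flag_proj I V)) ->
  X h = 'D_xi ht U.

Lemma pushes_unique U xi X Y : orthogonal_group U ->
  pushes U xi X -> pushes U xi Y -> X = Y.
Proof.
move=> hU pX pY; apply/funext => h.
have [ O [ht [oO OU sht eht]]] := smooth_fun_extension h hU.
by rewrite (pX h O ht) // (pY h O ht).
Qed.

Lemma pushes_linear a U xi eta X Y : pushes U xi X -> pushes U eta Y ->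
  pushes U (a *: xi + eta) (a *: X + Y).
Proof.
move=> pX pY h O ht oO OU sht eht.
rewrite (derive_linear_direction _ _ _ oO OU (sht 1%N)).
by rewrite -(pX h O ht oO OU sht eht) -(pY h O ht oO OU sht eht).
Qed.

Lemma pushes_velocity (c : R -> 'M[R]_n.+1) (W : R -> set 'M[R]_n.+1) (t0 : R) xi :
  (\forall t \near t0, orthogonal_group (c t) /\ W t = flag_proj I (c t)) ->
  is_derive t0 1 c xi -> pushes (c t0) xi (velocity W t0).
Proof.
move=> cW [dc <-] h O ht oO Oc sht eht.
have cc : {for t0, continuous c}.
  by apply: differentiable_continuous; exact/derivable1_diffP.
rewrite /velocity derive1E.
have [_ <-] := is_derive_mx_comp oO Oc (sht 1%N) dc.
apply: near_eq_derive; near=> t.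
have [oc ->] : orthogonal_group (c t) /\ W t = flag_proj I (c t) by near: t.
rewrite /= eht //; near: t; apply: cc; exact: open_nbhs_nbhs.
Unshelve. all: by end_near. Qed.

Lemma flag_proj_mul_block U Q : orthogonal_group U -> block_orthogonal I Q ->
  flag_proj I (U *m Q) = flag_proj I U.
Proof.
move=> hU bQ; apply/flag_proj_eqP => //; last exact: flag_mx_mul_block.
by apply: orthogonalM => //; have [] := bQ.
Qed.

Lemma is_derive_mul_cayley0 U B : Defs.skew B ->
  is_derive (0 : R) 1 (fun t => U *m cayley B t) (U *m B).
Proof.
move=> /is_derive_cayley0/is_derive_slope0P dB; apply/is_derive_slope0P.
have L : (fun t => U *m (t^-1 *: (cayley B t - cayley B 0))) @ 0^' --> U *m B.
  by apply: cvg_mulmx => //; exact: cvg_cst.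
by apply: near_cvg L; near=> t; rewrite -scalemxAr mulmxBr.
Unshelve. all: by end_near. Qed.

Lemma mul_cayley_orthogonal U B t : orthogonal_group U -> Defs.skew B ->
  orthogonal_group (U *m cayley B t).
Proof. by move=> hU sB; apply: orthogonalM => //; exact: cayley_orthogonal. Qed.

Lemma pushes_cayley U B : orthogonal_group U -> Defs.skew B ->
  pushes U (U *m B) (velocity (flag_proj I \o (fun t => U *m cayley B t)) 0).
Proof.
move=> hU sB; have := @pushes_velocity (fun t => U *m cayley B t)
  (flag_proj I \o (fun t => U *m cayley B t)) 0 (U *m B).
rewrite cayley0 mulmx1; apply; last exact: is_derive_mul_cayley0.
by near=> t; split => //; exact: mul_cayley_orthogonal.
Unshelve. all: by end_near. Qed.

(** A block-diagonal skew-symmetric direction is vertical: it is tangent to a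
    curve inside the fibre U O(I). *)
Lemma pushes_vertical U A : orthogonal_group U -> Defs.skew A ->
  A *m grading I = grading I *m A -> pushes U (U *m A) 0.
Proof.
move=> hU sA cA; have := pushes_cayley hU sA.
rewrite (_ : velocity _ 0 = 0) //; apply/funext => h; rewrite /velocity.
rewrite (_ : (fun s => _) = cst (h (flag_proj I U))); first exact: derive1_cst.
apply/funext => t /=; rewrite flag_proj_mul_block //; apply/block_orthogonalP.
by split; [exact: cayley_orthogonal|exact: cayley_comm].
Qed.

(** Two skew-symmetric matrices with the same off-diagonal blocks differ by a
    vertical direction. *)
Lemma pushes_mod_vertical U A B X : orthogonal_group U ->
  Defs.skew A -> Defs.skew B ->
  (forall i j, ~~ same_block I i j -> A i j = B i j) ->
  pushes U (U *m A) X -> pushes U (U *m B) X.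
Proof.
move=> hU sA sB AB pX.
have pV : pushes U (U *m (B - A)) 0.
  apply: pushes_vertical => //.
    by rewrite /Defs.skew/= raddfB/= sA sB opprB opprK addrC.
  by apply/grading_commP => i j nij; rewrite !mxE AB // subrr.
have := pushes_linear 1 pV pX.
by rewrite scaler0 add0r scale1r mulmxBr subrK.
Qed.

Definition flag_frame (W : set 'M[R]_n.+1) : 'M[R]_n.+1 :=
  xget 0 [set V | orthogonal_group V /\ flag_proj I V = W].

Lemma flag_frameP W : flags I W ->
  orthogonal_group (flag_frame W) /\ flag_proj I (flag_frame W) = W.
Proof.
case=> V hV VW; rewrite /flag_frame.
by apply: (xgetPex 0 (P := [set V | orthogonal_group V /\ flag_proj I V = W])); exists V.
Qed.

Lemma flag_mx_frame U : orthogonal_group U ->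
  flag_mx I (flag_frame (flag_proj I U)) = flag_mx I U.
Proof.
move=> hU; have [|hV] := @flag_frameP (flag_proj I U); first by exists U.
by move/flag_proj_eqP; apply.
Qed.

Lemma Ck_flag_mx k : Ck_open k setT (flag_mx I : 'M[R]_n.+1 -> 'M[R]_n.+1).
Proof.
have idC : Ck_open k setT (fun A : 'M[R]_n.+1 => A).
  by apply/(Ck_open_mxP k _ openT) => i j; apply: Ck_open_coord; exact: openT.
apply: Ck_open_mulmx; first exact: openT.
  by apply: Ck_open_mulmx => //; [exact: openT|exact: Ck_open_cst].
apply/(Ck_open_mxP k _ openT) => i j.
apply: (Ck_open_ext openT (h := fun A : 'M[R]_n.+1 => A j i)).
  by move=> A _; rewrite mxE.
by apply: Ck_open_coord; exact: openT.
Qed.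

Definition flag_coord_val k l (W : set 'M[R]_n.+1) : R := flag_mx I (flag_frame W) k l.

Fact flag_coord_smooth k l : smooth_on orthogonal_group (flag_coord_val k l \o flag_proj I).
Proof.
move=> U hU; exists setT, (fun V => flag_mx I V k l); split => //; first exact: openT.
  by move=> d; apply: ((Ck_open_mxP d _ openT).1 (Ck_flag_mx d)).
by move=> V _ hV; rewrite /= /flag_coord_val flag_mx_frame.
Qed.

Definition flag_coord k l : smooth_fun R n I := SmoothFun (flag_coord_smooth k l).

Lemma flag_coordE k l U : orthogonal_group U ->
  flag_coord k l (flag_proj I U) = flag_mx I U k l.
Proof. by move=> hU; rewrite /= /flag_coord_val flag_mx_frame. Qed.

Lemma derive_flag_mx U xi k l :
  'D_xi (fun V => flag_mx I V k l) U =
    (xi *m grading I *m U^T + U *m grading I *m xi^T) k l.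
Proof.
apply: cvg_lim => //.
pose T := xi *m grading I *m U^T + U *m grading I *m xi^T.
have L : (fun t : R => (T + t *: (xi *m grading I *m xi^T)) k l) @ 0^' --> T k l.
  rewrite -[in X in _ --> X](addr0 T) -[in X in _ --> X](scale0r (xi *m grading I *m xi^T)).
  apply: cvg_mx_coord; apply: cvgD; first exact: cvg_cst.
  by apply: cvgZr_tmp; exact: nbhs_dnbhs.
apply: near_cvg L; near=> t.
have t0 : t != 0 by near: t; exact: nbhs_dnbhs_neq.
have E : flag_mx I (t *: xi + U) = flag_mx I U + t *: (T + t *: (xi *m grading I *m xi^T)).
  rewrite /flag_mx raddfD/= linearZ/= mulmxDl mulmxDl !mulmxDr.
  rewrite -!scalemxAl -!scalemxAr /T !scalerDr [RHS]addrC !addrA.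
  by congr (_ + _); rewrite -addrA addrC.
rewrite /= E; set Z := T + _.
have -> : (flag_mx I U + t *: Z) k l - flag_mx I U k l = t * Z k l.
  by rewrite mxE addrAC subrr add0r mxE.
by rewrite /GRing.scale/= mulKf.
Unshelve. all: by end_near. Qed.

(** Evaluating a tangent vector on the coordinates of the embedding by
    symmetric matrices recovers its off-diagonal blocks. *)
Lemma pushes_flag_coord U A X : orthogonal_group U -> Defs.skew A ->
  pushes U (U *m A) X ->
  U^T *m (\matrix_(k, l) X (flag_coord k l)) *m U = A *m grading I - grading I *m A.
Proof.
move=> hU sA pX.
have -> : \matrix_(k, l) X (flag_coord k l) =
    U *m (A *m grading I - grading I *m A) *m U^T.
  apply/matrixP => k l; rewrite mxE.
  rewrite (pX _ setT (fun V => flag_mx I V k l)) //; first 1 last.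
  - exact: openT.
  - by move=> d; apply: ((Ck_open_mxP d _ openT).1 (Ck_flag_mx d)).
  - by move=> V _ hV; rewrite flag_coordE.
  rewrite derive_flag_mx trmx_mul sA mulmxBr mulmxBl; congr (fun_of_matrix (_ + _) k l).
    by rewrite !mulmxA.
  by rewrite mulNmx mulmxN !mulmxA.
by rewrite -!mulmxA hU mulmx1 mulmxA hU mul1mx.
Qed.

(** The inversion of B -> [B, D] expresses the horizontal lift by the values of
    the tangent vector on finitely many smooth functions. *)
Lemma pushes_entry U B X i j : orthogonal_group U -> horizontal_space I B ->
  pushes U (U *m B) X ->
  B i j = inv_gap I i j * (U^T *m (\matrix_(k, l) X (flag_coord k l)) *m U) i j.
Proof.
move=> hU [sB bB] pX; rewrite (pushes_flag_coord hU sB pX) grading_bracketE /inv_gap.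
case: ifP => [/bB->|nij]; first by rewrite mul0r.
by rewrite mulrCA mulVf ?mulr1 // grade_gap_eq0 nij.
Qed.

Lemma pushes_horizontal_unique U B C X : orthogonal_group U ->
  horizontal_space I B -> horizontal_space I C ->
  pushes U (U *m B) X -> pushes U (U *m C) X -> B = C.
Proof.
move=> hU hB hC pB pC; apply/matrixP => i j.
by rewrite (pushes_entry i j hU hB pB) (pushes_entry i j hU hC pC).
Qed.

End Pushforward.

Lemma Ck_on_derivable (R : realType) (V W : normedModType R) (S : set V)
    (c : V -> W) x v : Ck_on 1 S c -> nbhs x S -> derivable c x v.
Proof.
move=> Hc nS; have [ O [c' [oO Ox [_ dc] ec]]] := Hc x (nbhs_singleton nS).
have [dcv _] := dc v; apply: near_eq_derivable (dcv x Ox).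
near=> y; apply: ec; near: y => //; exact: open_nbhs_nbhs.
Unshelve. all: by end_near. Qed.

Section TangentLifts.
Context {R : realType} {n : nat} (I : seq nat).
Implicit Types (U Q A B xi : 'M[R]_n.+1) (X Y : smooth_fun R n I -> R)
  (h : smooth_fun R n I).

Lemma horizontal_liftP U X xi : orthogonal_group U ->
  horizontal_lift U X xi <->
  exists B, [/\ horizontal_space I B, xi = U *m B & pushes U (U *m B) X].
Proof.
move=> hU; split.
  move=> [[B hB xiB] [c [[C1 oc] c0 dc ->]]]; exists B; split => //.
  rewrite -xiB -c0; apply: pushes_velocity; first by near=> t; split.
  rewrite -dc derive1E; apply: DeriveDef => //.
  by apply: Ck_on_derivable C1 _; exact: filterT.
move=> [B [hB -> pX]]; split; first by exists B.
have [sB _] := hB; exists (fun t => U *m cayley B t); split.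
- split=> [t _|t]; last exact: mul_cayley_orthogonal.
  have cC : Ck_open 1 setT (fun t => U *m cayley B t).
    by apply: Ck_open_mulmx; [exact: openT|exact: Ck_open_cst|exact: cayley_Ck].
  by exists setT, (fun t => U *m cayley B t); split; [exact: openT| |exact: cC|].
- by rewrite cayley0 mulmx1.
- by rewrite derive1E; case: (is_derive_mul_cayley0 U sB).
- exact: pushes_unique hU pX (pushes_cayley hU sB).
Unshelve. all: by end_near. Qed.

(** A path of flags lifts to the closest frames, which are differentiable at 0;
    a horizontal direction is realized by a Cayley curve. *)
Lemma flag_tangentP U X : orthogonal_group U ->
  flag_tangent (flag_proj I U) X <->
  exists2 B, horizontal_space I B & pushes U (U *m B) X.
Proof.
move=> hU; split.
  move=> [c [[cF cC] c0 ->]].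
  pose V t := flag_frame I (c t).
  have VP t : orthogonal_group (V t) /\ flag_proj I (V t) = c t.
    by apply: flag_frameP; exact: cF.
  have dV : derivable (fun t => flag_mx I (V t)) (0 : R) 1.
    apply/derivable_mxP => i j.
    have -> : (fun t => flag_mx I (V t) i j) = (fun t => flag_coord I i j (c t)) by [].
    by apply: Ck_on_derivable (cC (flag_coord I i j)) _; exact: filterT.
  have [||Lf [oL eL L0 [B hB dL]]] := @flag_lift R n I U V _ hU _ _ (derivableP dV).
  - by move=> t; have [] := VP t.
  - by rewrite /V c0; exact: flag_mx_frame.
  exists B => //; rewrite -{1}L0; apply: pushes_velocity => //.
  near=> t; split => //; have [oV <-] := VP t.
  by apply/flag_proj_eqP.
move=> [B hB pX]; have [sB _] := hB.
have oc t := mul_cayley_orthogonal t hU sB.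
exists (flag_proj I \o (fun t => U *m cayley B t)); split.
- split=> [t _|h t _]; first by exists (U *m cayley B t).
  have [ O [ht [oO Ot sht eht]]] := smooth_fun_extension h (oc t).
  have cC : Ck_open 1 setT (fun t => U *m cayley B t).
    by apply: Ck_open_mulmx; [exact: openT|exact: Ck_open_cst|exact: cayley_Ck].
  exists (setT `&` (fun t => U *m cayley B t) @^-1` O), (ht \o (fun t => U *m cayley B t)).
  split.
  + by have [cc _] := cC; exact: (open_preimage_on openT oO cc).
  + by [].
  + exact: (C1_open_mx_comp openT oO cC (sht 1%N)).
  + by move=> s [_ Os] _ /=; rewrite eht.
- by rewrite /= cayley0 mulmx1.
- exact: pushes_unique hU pX (pushes_cayley hU sB).
Unshelve. all: by end_near. Qed.

Lemma unique_horizontal_lift U B X : orthogonal_group U -> horizontal_space I B ->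
  pushes U (U *m B) X -> unique (horizontal_lift U X) (U *m B).
Proof.
move=> hU hB pX; split; first by apply/horizontal_liftP => //; exists B.
move=> _ /(horizontal_liftP _ _ hU)[C [hC -> pC]].
by rewrite (pushes_horizontal_unique hU hB hC pX pC).
Qed.

Lemma horizontal_space_block_congr Q B : block_orthogonal I Q ->
  horizontal_space I B -> horizontal_space I (Q^T *m B *m Q).
Proof.
move=> [hQ bQ] [sB bB]; split.
  by rewrite /Defs.skew/= !trmx_mul trmxK sB mulNmx mulmxN mulmxA.
move=> i j sij; rewrite mxE big1 // => l _; rewrite mxE.
have [slj|/bQ->] := boolP (same_block I l j); last by rewrite mulr0.
rewrite big1 ?mul0r // => k _; rewrite mxE.
have [ski|/bQ->] := boolP (same_block I k i); last by rewrite mul0r.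
rewrite bB ?mulr0 //; apply: same_block_trans ski _.
by apply: same_block_trans sij _; rewrite same_block_sym.
Qed.

Lemma flag_proj_frame U V : flag_proj I U = flag_proj I V ->
  exists2 Q, block_orthogonal I Q & V = U *m Q.
Proof.
by move=> UV; have := flag_proj_self I V; rewrite -UV => -[Q bQ <-]; exists Q.
Qed.

(** Changing the representative U of a flag to U Q conjugates by Q the
    coordinates of the horizontal lifts. *)
Lemma pushes_change_frame U Q B C X : orthogonal_group U -> block_orthogonal I Q ->
  horizontal_space I B -> horizontal_space I C ->
  pushes U (U *m B) X -> pushes (U *m Q) (U *m Q *m C) X -> C = Q^T *m B *m Q.
Proof.
move=> hU bQ hB hC pB pC.
have hC' := horizontal_space_block_congr bQ hB.
have [sB _] := hB; have [sC _] := hC.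
have [hQ cQ] := (block_orthogonalP I Q).1 bQ.
have hV : orthogonal_group (U *m Q) by exact: orthogonalM.
have cQT : Q^T *m grading I = grading I *m Q^T.
  rewrite -[LHS](mulmx1 (Q^T *m grading I)) -(orthogonal_mulT hQ) -!mulmxA.
  by rewrite [grading I *m (Q *m _)]mulmxA -cQ !mulmxA hQ mul1mx.
have E := pushes_flag_coord hU sB pB.
apply/matrixP => i j; rewrite (pushes_entry i j hV hC pC).
have -> M : (U *m Q)^T *m M *m (U *m Q) = Q^T *m (U^T *m M *m U) *m Q.
  by rewrite trmx_mul !mulmxA.
rewrite E; have -> : Q^T *m (B *m grading I - grading I *m B) *m Q =
   (Q^T *m B *m Q) *m grading I - grading I *m (Q^T *m B *m Q).
  rewrite mulmxBr mulmxBl; congr (_ - _); last by rewrite !mulmxA cQT.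
  by rewrite -!mulmxA cQ.
rewrite grading_bracketE /inv_gap; have [_ bC'] := hC'.
case: ifP => [/bC'->|nij]; first by rewrite mul0r.
by rewrite mulrCA mulVf ?mulr1 // grade_gap_eq0 nij.
Qed.

End TangentLifts.

(** * The metric on a cell *)

Section MetricValue.
Context {R : realType} {n : nat} (K : {set 'I_n.+1}).
Variable (f : 'rV[R]_n.+1 -> R).
Let I := type_of K.
Implicit Types (U B C : 'M[R]_n.+1) (X Y : smooth_fun R n I -> R).

(** Conjugating by a block-diagonal orthogonal matrix preserves the formula,
    because its weights are constant on the blocks. *)
Lemma metricE mu alpha beta U B C X Y : open_simplex K mu ->
  orthogonal_group U -> horizontal_space I B -> horizontal_space I C ->
  pushes U (U *m B) X -> pushes U (U *m C) Y ->
  metric f (mu, flag_proj I U) ((alpha, X) : tvec R n K) (beta, Y) =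
  metric_formula f mu alpha beta B C.
Proof.
move=> muK hU hB hC pX pY; rewrite /metric; apply: xget_unique.
  exists U, (U *m B), (U *m C); split => //=.
  - by apply/horizontal_liftP => //; exists B.
  - by apply/horizontal_liftP => //; exists C.
  - by rewrite !orthogonal_mulK.
move=> y [V [Xt [Yt [/= hV VU lX lY ->]]]].
have [B' [hB' -> pB']] := (horizontal_liftP _ _ hV).1 lX.
have [C' [hC' -> pC']] := (horizontal_liftP _ _ hV).1 lY.
rewrite !orthogonal_mulK //.
have [Q bQ VE] := flag_proj_frame (esym VU); subst V.
rewrite (pushes_change_frame hU bQ hB hB' pX pB').
rewrite (pushes_change_frame hU bQ hC hC' pY pC').
rewrite !metric_formula_weight (@upper_sum_block_congr _ _ I) //.
- by move=> i j; exact: window_weight_sym.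
- exact: window_weight_block_constant.
- by case: hB.
- by case: hC.
Qed.

Lemma tau_open_simplex mu : open_simplex K mu -> @tau R n mu = I.
Proof.
move=> [_ muK]; rewrite /tau /I; congr type_of; apply/setP => i; rewrite finset.in_set.
apply/idP/idP => [|/((muK i).1)//].
by apply: contraTT => /((muK i).2)->; rewrite ltxx.
Qed.

Lemma cell_flag (p : 'rV[R]_n.+1 * set 'M[R]_n.+1) : cell K p ->
  open_simplex K p.1 /\ exists2 U, orthogonal_group U & flag_proj I U = p.2.
Proof.
move=> [[_]] + muK; rewrite (tau_open_simplex muK) => -[U hU UW]; split => //.
by exists U.
Qed.

Lemma cell_mk mu U : open_simplex K mu -> orthogonal_group U -> cell K (mu, flag_proj I U).
Proof.
move=> muK hU; split => //; split; first by case: muK.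
by rewrite /= (tau_open_simplex muK); exists U.
Qed.

End MetricValue.

Section MetricProperties.
Context {R : realType} {n : nat} (K : {set 'I_n.+1}).
Variable (f : 'rV[R]_n.+1 -> R).
Hypothesis f_ge0 : forall mu, cube mu -> 0 <= f mu.
Hypothesis f_eq0 : forall mu, cube mu -> (f mu = 0 <-> mu = 0).
Let I := type_of K.

Lemma window_cube mu (i j : 'I_n.+1) : @cube R n mu -> cube (window mu i j).
Proof.
by move=> cmu l; rewrite mxE; case: ifP => _; [exact: cmu|rewrite lexx ler01].
Qed.

Lemma window_f_gt0 mu (i j : 'I_n.+1) : open_simplex K mu -> (i < j)%N ->
  ~~ same_block I i j -> 0 < f (window mu i j).
Proof.
move=> muK ij nij; have [[cmu _] _] := muK.
rewrite lt_def f_ge0 ?andbT; last exact: window_cube.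
apply/eqP => /(f_eq0 (window_cube i j cmu)).1 /(window_eq0 muK (ltnW ij)).
by rewrite -/I (negPf nij).
Qed.

(** Fixing a frame identifies the tangent space with pairs of a tangent vector
    of the simplex and a horizontal matrix, where the metric is a weighted sum
    of squares; the weights of the entries outside of the diagonal blocks are
    positive. *)
Lemma metric_inner_product p : cell K p -> inner_product_on (cell_tangent p) (metric f (K := K) p).
Proof.
case: p => mu W cp; have [/= muK [U hU UW]] := cell_flag cp.
rewrite -{W cp}UW in cp *.
have tangentE (u : tvec R n K) : cell_tangent (mu, flag_proj I U) u <->
    simplex_tangent K u.1 /\ exists2 B, horizontal_space I B & pushes U (U *m B) u.2.
  by split=> -[su tu]; split => //; apply/flag_tangentP.
have valE (u v : tvec R n K) B C : horizontal_space I B -> horizontal_space I C ->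
    pushes U (U *m B) u.2 -> pushes U (U *m C) v.2 ->
    metric f (mu, flag_proj I U) u v = metric_formula f mu u.1 v.1 B C.
  by case: u v => [alpha X] [beta Y] hB hC /= pX pY; exact: metricE.
have hlin a B C : horizontal_space I B -> horizontal_space I C -> horizontal_space I (a *: B + C).
  move=> [sB bB] [sC bC]; split.
    by rewrite /Defs.skew/= raddfD/= linearZ/= sB sC opprD scalerN.
  by move=> i j sij; rewrite !mxE bB // bC // mulr0 addr0.
have plin a (X Y : smooth_fun R n I -> R) B C : pushes U (U *m B) X -> pushes U (U *m C) Y ->
    pushes U (U *m (a *: B + C)) (a *: X + Y).
  by move=> pX pY; rewrite mulmxDr -scalemxAr; exact: pushes_linear.
split.
- split.
    apply/tangentE; split.
      by split=> [j _|]; rewrite ?mxE // big1 // => i _; rewrite mxE.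
    exists 0; first by split=> [|i j _]; rewrite ?mxE // /Defs.skew/= trmx0 oppr0.
    by move=> h O ht oO OU sht eht; rewrite mulmx0 derive0.
  move=> a u v /tangentE[[u0 su] [B hB pB]] /tangentE[[v0 sv] [C hC pC]].
  apply/tangentE; split; last by exists (a *: B + C); [exact: hlin|exact: plin].
  split=> [j jK|]; first by rewrite !mxE u0 // v0 // mulr0 addr0.
  under eq_bigr do rewrite !mxE.
  by rewrite big_split -mulr_sumr /= su sv mulr0 addr0.
- move=> u v /tangentE[_ [B hB pB]] /tangentE[_ [C hC pC]].
  rewrite (valE _ _ B C) // (valE _ _ C B) // /metric_formula; congr (_ + _).
    by apply: eq_bigr => i _; rewrite mulrC.
  by apply: eq_bigr => i _; apply: eq_bigr => j _; rewrite mulrAC.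
- move=> a u v w /tangentE[_ [B hB pB]] /tangentE[_ [C hC pC]] /tangentE[_ [D hD pD]].
  rewrite (valE _ _ (a *: B + C) D) //; [|exact: hlin|exact: plin].
  rewrite (valE _ _ B D) // (valE _ _ C D) // /metric_formula.
  rewrite mulrDr addrACA; congr (_ + _).
    rewrite mulr_sumr -big_split; apply: eq_bigr => i _ /=.
    by rewrite !mxE mulrDl mulrA.
  rewrite mulr_sumr -big_split; apply: eq_bigr => i _ /=.
  rewrite mulr_sumr -big_split; apply: eq_bigr => j _ /=.
  by rewrite !mxE; ring.
- move=> u /tangentE[_ [B hB pB]] u0; rewrite (valE _ _ B B) // /metric_formula.
  have s1 : 0 <= \sum_i u.1 0 i * u.1 0 i by apply: sumr_ge0 => i _; rewrite -expr2 sqr_ge0.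
  have t0 i j : 0 <= f (window mu i j) ^+ 2 * B i j * B i j.
    by rewrite -mulrA -expr2 mulr_ge0 ?sqr_ge0.
  have s2 : 0 <= \sum_(i < n.+1) \sum_(j < n.+1 | (i < j)%N) f (window mu i j) ^+ 2 * B i j * B i j.
    by apply: sumr_ge0 => i _; apply: sumr_ge0 => j _.
  have [B0|] := pselect (B = 0).
    have X0 : u.2 = 0.
      apply: (pushes_unique hU pB) => h O ht oO OU sht eht.
      by rewrite B0 mulmx0 derive0.
    have [i ui] : exists i, u.1 0 i != 0.
      apply: contrapT => H; move/eqP: u0; apply; case: u {pB valE s1} X0 H => alpha X /= -> H.
      congr pair; apply/rowP => i; rewrite mxE; apply/eqP/negPn/negP => ai.
      by apply: H; exists i.
    apply: ltr_wpDr => //; rewrite (bigD1 i)//= ltr_pwDl //.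
      by rewrite -expr2 exprn_even_gt0.
    by apply: sumr_ge0 => k _; rewrite -expr2 sqr_ge0.
  move=> B0; have [sB bB] := hB.
  have [i [j [ij Bij]]] : exists i j : 'I_n.+1, (i < j)%N /\ B i j != 0.
    apply: contrapT => H; apply: B0.
    have up (i j : 'I_n.+1) : (i < j)%N -> B i j = 0.
      by move=> ij; apply/eqP/negPn/negP => Bij; apply: H; exists i, j.
    apply/matrixP => i j; rewrite mxE; case: (ltngtP i j) => [/up//|ji|/val_inj ->].
      by rewrite skewE // up // oppr0.
    exact: skew_diag.
  have nij : ~~ same_block I i j by apply: contra Bij => /bB->.
  apply: ltr_wpDl => //; rewrite (bigD1 i)//= ltr_pwDl //; last first.
    by apply: sumr_ge0 => k _; apply: sumr_ge0 => l _.
  rewrite (bigD1 j)//= ltr_pwDl //; last by apply: sumr_ge0 => l _.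
  rewrite -mulrA -expr2 mulr_gt0 //; last by rewrite exprn_even_gt0.
  by rewrite exprn_gt0 // window_f_gt0.
Qed.

End MetricProperties.

Section MetricRegularity.
Context {R : realType} {n : nat} (K : {set 'I_n.+1}).
Variable (f : 'rV[R]_n.+1 -> R).
Hypothesis f_ge0 : forall mu, cube mu -> 0 <= f mu.
Hypothesis f_eq0 : forall mu, cube mu -> (f mu = 0 <-> mu = 0).
Hypothesis f_C2 : Ck_on 2 (cube `\ 0) f.
Let I := type_of K.

Lemma metric_well_defined (mu : 'rV[R]_n.+1) (W : set 'M[R]_n.+1)
    (alpha beta : 'rV[R]_n.+1) (X Y : smooth_fun R n (type_of K) -> R) :
  cell K (mu, W) ->
  cell_tangent (mu, W) ((alpha, X) : tvec R n K) ->
  cell_tangent (mu, W) ((beta, Y) : tvec R n K) ->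
  forall U : 'M[R]_n.+1, orthogonal_group U -> flag_proj (type_of K) U = W ->
    exists Xt Yt : 'M[R]_n.+1,
      [/\ unique (horizontal_lift U X) Xt,
          unique (horizontal_lift U Y) Yt
        & metric f (mu, W) ((alpha, X) : tvec R n K) (beta, Y) =
          metric_formula f mu alpha beta (U^T *m Xt) (U^T *m Yt)].
Proof.
move=> /cell_flag[/= muK _] [_ /= tX] [_ /= tY] U hU UW; subst W.
have [B hB pB] := (flag_tangentP _ hU).1 tX.
have [C hC pC] := (flag_tangentP _ hU).1 tY.
exists (U *m B), (U *m C); split; [exact: unique_horizontal_lift..|].
by rewrite !orthogonal_mulK //; exact: metricE.
Qed.

Let E : normedModType R := ('rV[R]_n.+1 * 'M[R]_n.+1)%type.
Let S : set E := open_simplex K `*` orthogonal_group.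

Lemma Ck_on_frame_coord k i j : Ck_on k S (fun q : E => q.2 i j).
Proof.
apply: (@Ck_on_comp_linear R _ E R k setT S (fun q : E => q.2) (fun A : 'M[R]_n.+1 => A i j)) => //.
  by move=> q; exact: cvg_snd.
move=> A _; exists setT, (fun A : 'M[R]_n.+1 => A i j); split => //; first exact: openT.
by apply: Ck_open_coord; exact: openT.
Qed.

(** Within a block the window is 0 on the whole cell.  Otherwise it is nonzero
    there, so that it avoids the point where f may fail to be of class
    C^2. *)
Lemma Ck_on_window_sq (i j : 'I_n.+1) : (i < j)%N -> Ck_on 2 S (fun q : E => f (window q.1 i j) ^+ 2).
Proof.
move=> ij; have [sij|nij] := boolP (same_block I i j).
  apply: (Ck_on_ext _ (@Ck_on_cst R E _ 2 S (f 0 ^+ 2 : R))) => q [muK _] /=.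
  by congr (f _ ^+ 2); apply/esym/(window_eq0 muK (ltnW ij)).
have Cf : Ck_on 2 S (fun q : E => f (window q.1 i j)).
  apply: (@Ck_on_comp_linear R _ E R 2 (cube `\ 0) S (fun q : E => window q.1 i j) f) => //.
  - move=> q; apply: cvg_mx => a b; rewrite mxE.
    rewrite (_ : (fun t : E => _) = fun t : E => if (i <= b < j)%N then t.1 0 b else 0); last first.
      by apply/funext => t; rewrite mxE.
    case: ifP => _; last exact: cvg_cst.
    apply: cvg_mx_coord; exact: cvg_fst.
  - move=> a u v; apply/rowP => l; rewrite !mxE; case: ifP => // _.
    by rewrite mulr0 addr0.
  - move=> q [muK _]; have [[cmu _] _] := muK; split; first exact: window_cube.
    by move=> /(window_eq0 muK (ltnW ij)); rewrite -/I (negPf nij).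
by apply: (Ck_on_ext _ (Ck_onM Cf Cf)) => q _; rewrite expr2.
Qed.

(** The coordinates of the horizontal lift at U of the second component of a
    vector field, read off from its values on the coordinate functions. *)
Definition lift_entry (xi : 'rV[R]_n.+1 * set 'M[R]_n.+1 -> tvec R n K) (i j : 'I_n.+1)
    (q : E) : R :=
  inv_gap I i j * \sum_l (\sum_k q.2 k i *
    (xi (q.1, flag_proj I q.2)).2 (flag_coord I k l)) * q.2 l j.

Lemma Ck_on_lift_entry xi (i j : 'I_n.+1) : smooth_vector_field xi -> Ck_on 2 S (lift_entry xi i j).
Proof.
move=> [_ _ s2]; apply: (@Ck_onM R E 2 S (fun=> inv_gap I i j)); first exact: Ck_on_cst.
apply: Ck_on_sum => l _; apply: Ck_onM; last exact: Ck_on_frame_coord.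
apply: Ck_on_sum => k _; apply: Ck_onM; first exact: Ck_on_frame_coord.
exact: (smooth_Ck_on 2 (s2 (flag_coord I k l))).
Qed.

Lemma lift_entryE xi (i j : 'I_n.+1) (q : E) B : orthogonal_group q.2 ->
  horizontal_space I B -> pushes q.2 (q.2 *m B) (xi (q.1, flag_proj I q.2)).2 ->
  B i j = lift_entry xi i j q.
Proof.
move=> hU hB pB; rewrite (pushes_entry i j hU hB pB); congr (_ * _).
rewrite mxE; apply: eq_bigr => l _; congr (_ * _); rewrite mxE.
by apply: eq_bigr => k _; rewrite !mxE.
Qed.

(** Pulled back to the frames, the metric evaluated on two vector fields is a
    polynomial in functions that are of class C^2. *)
Lemma metric_riemannian : riemannian_metric 2 (metric f (K := K)).
Proof.
split=> [p|xi eta sxi seta]; first exact: metric_inner_product.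
have [txi sxi1 _] := sxi; have [teta seta1 _] := seta.
pose F (q : E) := \sum_i (xi (q.1, flag_proj I q.2)).1 0 i * (eta (q.1, flag_proj I q.2)).1 0 i +
  \sum_(i < n.+1) \sum_(j < n.+1 | (i < j)%N)
     f (window q.1 i j) ^+ 2 * lift_entry xi i j q * lift_entry eta i j q.
apply: (Ck_on_ext (h := F)); last first.
  apply: Ck_onD.
    apply: Ck_on_sum => i _; apply: Ck_onM.
      exact: Ck_on_mx_coord (smooth_Ck_on 2 sxi1).
    exact: Ck_on_mx_coord (smooth_Ck_on 2 seta1).
  apply: Ck_on_sum => i _; apply: Ck_on_sum => j ij.
  apply: Ck_onM; last exact: Ck_on_lift_entry.
  by apply: Ck_onM; [exact: Ck_on_window_sq|exact: Ck_on_lift_entry].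
move=> [mu U] [/= muK hU]; rewrite /F /cell_pull /=.
have cp := cell_mk muK hU.
have [_ /(flag_tangentP _ hU)[B hB pB]] := txi _ cp.
have [_ /(flag_tangentP _ hU)[C hC pC]] := teta _ cp.
have := metricE f (xi (mu, flag_proj I U)).1 (eta (mu, flag_proj I U)).1 muK hU hB hC pB pC.
rewrite -!surjective_pairing => ->; congr (_ + _).
apply: eq_bigr => i _; apply: eq_bigr => j _.
by rewrite (@lift_entryE xi i j (mu, U) B) // (@lift_entryE eta i j (mu, U) C).
Qed.

End MetricRegularity.

(** * Piecewise C^1 curves and integration off a finite set *)

Section PiecewiseC1.
Context {R : realType} {W : normedModType R}.
Implicit Types (g : R -> W) (x y a b t : R).

Lemma C1_segment_interior x y g t : Ck_on 1 `[x, y] g -> t \in `]x, y[ ->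
  derivable g t 1 /\ {for t, continuous (derive1 g)}.
Proof.
move=> Hg tI; have nI : nbhs t `]x, y[%classic.
  by apply: open_nbhs_nbhs; split; [exact: interval_open|].
have nS : nbhs t `[x, y]%classic by apply: filterS nI; exact: subset_itv_oo_cc.
split; first exact: Ck_on_derivable Hg nS.
have [ O [h [oO Ot [_ dh] eh]]] := Hg t (nbhs_singleton nS).
have [_ [cD _]] := dh 1.
apply: near_eq_continuous_at (cD t Ot).
have : \forall u \near t, (O `&` `]x, y[%classic) u.
  by apply: filterI => //; exact: open_nbhs_nbhs.
apply: filterS => u [Ou uI]; rewrite derive1E; apply: near_eq_derive.
have : nbhs u (O `&` `]x, y[%classic).
  by apply: open_nbhs_nbhs; split => //; apply: openI => //; exact: interval_open.
by apply: filterS => v [Ov vI]; rewrite eh //; exact: (subset_itv_oo_cc vI).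
Qed.

(** Around each point of the closed segment, end points included, the
    derivative agrees inside with that of a C^1 extension, so it is locally
    bounded; the compactness of the segment makes the bound uniform. *)
Lemma C1_segment_bounded x y g : Ck_on 1 `[x, y] g ->
  exists M, forall t, t \in `]x, y[ -> `|derive1 g t| <= M.
Proof.
move=> Hg.
have cov : near_covering `[x, y]%classic.
  by apply/compact_near_coveringP; exact: segment_compact.
have H := cov R (pinfty_nbhs R) (fun M t => t \in `]x, y[ -> `|derive1 g t| <= M) _ _.
have /filter_ex[M HM] : \forall M \near +oo,
    `[x, y]%classic `<=` (fun t => t \in `]x, y[ -> `|derive1 g t| <= M).
  apply: H => p pI; have [ O [h [oO Op [_ dh] eh]]] := Hg p pI.
  have [_ [cD _]] := dh 1.
  have nb : \forall t \near p, O t /\ `|'D_1 h t| < `|'D_1 h p| + 1.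
    apply: filterI; first exact: open_nbhs_nbhs.
    have L : 'D_1 h @ p --> 'D_1 h p := cD p Op.
    have l1 : `|'D_1 h p| < `|'D_1 h p| + 1 by rewrite ltrDl.
    exact: (@cvgr_norm_lt _ _ _ (nbhs p) _ ('D_1 h) ('D_1 h p) L _ l1).
  exists ([set t | O t /\ `|'D_1 h t| < `|'D_1 h p| + 1], [set M | `|'D_1 h p| + 1 < M]).
    by split => //=; exact: nbhs_pinfty_gt.
  move=> [t M] [/= [Ot Dt] DM] tI.
  have -> : derive1 g t = 'D_1 h t.
    rewrite derive1E; apply: near_eq_derive.
    have : nbhs t (O `&` `]x, y[%classic).
      by apply: open_nbhs_nbhs; split => //; apply: openI => //; exact: interval_open.
    by apply: filterS => v [Ov vI]; rewrite eh //; exact: (subset_itv_oo_cc vI).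
  by apply/ltW/(lt_trans Dt).
by exists M => t tI; apply: HM => //; exact: (subset_itv_oo_cc tI).
Qed.

(** The exceptional points are those of the partition. *)
Lemma piecewise_C1_derive1 a b g : piecewise (fun x y => Ck_on 1 `[x, y] g) a b ->
  exists (s : seq R) (M : R), forall t, t \in `]a, b[ -> t \notin s ->
    [/\ derivable g t 1, {for t, continuous (derive1 g)} & `|derive1 g t| <= M].
Proof.
case=> s; elim: s a => [|x s IH] a.
  move=> [_ /eqP <-] _; exists [::], 0 => t; rewrite in_itv/= => /andP[at_ ta].
  by have := lt_trans at_ ta; rewrite ltxx.
move=> [/= /andP[ax px] lx] H.
have [|i si|s1 [M1 H1]] := IH x; first by split.
  exact: (H i.+1).
have Hx := H 0%N isT; rewrite /= in Hx.
have [M0 H0] := C1_segment_bounded Hx.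
exists (x :: s1), (Num.max M0 M1) => t; rewrite in_itv/= inE negb_or => /andP[at_ tb] /andP[tx ts].
have [tltx|xltt|tex] := ltgtP t x; last by rewrite tex eqxx in tx.
  have tI : t \in `]a, x[ by rewrite in_itv/= at_ tltx.
  have [? ?] := C1_segment_interior Hx tI.
  by split => //; rewrite le_max H0.
have [|//|? ? ?] := H1 t; first by rewrite in_itv/= xltt tb.
by split => //; rewrite le_max; apply/orP; right.
Qed.

End PiecewiseC1.

Section BoundedOffFinite.
Context {R : realType}.
Variables (a b M : R) (s : seq R) (phi : R -> R).
Hypothesis phiC : forall t, t \in `]a, b[ -> t \notin s -> {for t, continuous phi}.
Hypothesis phiM : forall t, t \in `]a, b[ -> t \notin s -> `|phi t| <= M.

Definition exceptional_set : set R := [set` (a :: b :: s)].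

Definition regular_set : set R := `[a, b]%classic `\` exceptional_set.

Lemma countable_exceptional : countable exceptional_set.
Proof. exact/finite_set_countable/finite_seq. Qed.

Lemma measurable_exceptional : measurable exceptional_set.
Proof. by apply: countable_measurable => //; exact: countable_exceptional. Qed.

Lemma exceptional_measure0 : lebesgue_measure exceptional_set = 0%E.
Proof. exact: countable_lebesgue_measure0 countable_exceptional. Qed.

Lemma off_exceptional t : regular_set t <->
  (t \in `]a, b[) /\ t \notin s.
Proof.
rewrite /regular_set /exceptional_set /= !in_cons; split.
  move=> [+ /negP]; rewrite in_itv/= !negb_or => /andP[at_ tb] /and3P[ta tnb ts].
  by rewrite in_itv/= !lt_def ta at_ [b == t]eq_sym tnb tb.
rewrite !in_itv/= => -[/andP[at_ tb] ts]; split; first by rewrite !ltW.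
by apply/negP; rewrite !negb_or ts (gt_eqF at_) (lt_eqF tb).
Qed.

Lemma open_regular_set : open regular_set.
Proof.
rewrite (_ : regular_set = `]a, b[%classic `&` ~` [set` s]).
  apply: openI; first exact: interval_open.
  by rewrite openC; apply: compact_closed; [exact: Rhausdorff|exact/finite_compact/finite_seq].
apply/seteqP; split=> t.
  by move=> /off_exceptional[tI ts]; split => //; exact/negP.
by move=> [tI /negP ts]; apply/off_exceptional.
Qed.

Lemma measurable_fun_off_exceptional :
  measurable_fun regular_set phi.
Proof.
apply: open_continuous_measurable_fun; first exact: open_regular_set.
move=> t; rewrite inE => /off_exceptional[tI ts]; exact: phiC.
Qed.

Lemma measurable_fun_segment : measurable_fun `[a, b]%classic phi.
Proof.
move=> mD Y mY.
rewrite (_ : _ `&` _ = (regular_set `&` phi @^-1` Y) `|`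
   ((`[a, b]%classic `&` exceptional_set) `&` phi @^-1` Y)).
  apply: measurableU.
    apply: measurable_fun_off_exceptional => //.
    by apply: measurableD => //; exact: measurable_exceptional.
  apply: countable_measurable => //; apply: sub_countable countable_exceptional.
  by apply: subset_card_le => t [[]].
by rewrite -setIUl setUC setUIDK.
Qed.

Lemma integrable_off_exceptional :
  lebesgue_measure.-integrable `[a, b] (EFin \o phi).
Proof.
have mphi : measurable_fun `[a, b]%classic (fun t => (phi t)%:E).
  by apply/measurable_EFinP; exact: measurable_fun_segment.
have [_ H] := negligible_integrable (mu := @lebesgue_measure R) measurable_exceptional
  (measurable_itv `[a, b]) mphi exceptional_measure0; apply: H.
rewrite -/regular_set.
apply: measurable_bounded_integrable.
- by apply: measurableD => //; exact: measurable_exceptional.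
- apply: (@le_lt_trans _ _ (lebesgue_measure `[a, b]%classic)).
    apply: le_measure; rewrite ?inE //; last by apply: subDsetl.
    by apply: measurableD => //; exact: measurable_exceptional.
  by rewrite lebesgue_measure_itv /=; case: ifP => _; rewrite -?EFinB ltry.
- exact: measurable_fun_off_exceptional.
exists M; split; first exact: num_real.
by move=> N MN t /off_exceptional[tI ts]; apply: le_trans (ltW MN); exact: phiM.
Qed.

End BoundedOffFinite.

(** * Speed and length *)

Lemma mx_entry_le_norm (R : realType) m n (A : 'M[R]_(m, n)) i j : `|A i j| <= `|A|.
Proof.
by rewrite [leRHS]/Num.Def.normr/= mx_normrE; exact: (le_bigmax _ _ (i, j)).
Qed.

Lemma derivable1_continuous_at (R : realType) (W : normedModType R) (c : R -> W) (t : R) :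
  derivable c t 1 -> {for t, continuous c}.
Proof. by move=> dc; apply: differentiable_continuous; exact/derivable1_diffP. Qed.

(** The derivative of the constant function U^T U vanishes. *)
Lemma orthogonal_curve_skew (R : realType) n (U : R -> 'M[R]_n.+1) (t : R) xi :
  (\forall u \near t, orthogonal_group (U u)) -> is_derive t 1 U xi ->
  Defs.skew ((U t)^T *m xi).
Proof.
move=> oU dU; have oUt := nbhs_singleton oU.
have S := (is_derive_slopeP U t xi).1 dU; pose s h := h^-1 *: (U (h + t) - U t).
have s0 : s @ 0^' --> xi by exact: S.
have sT : (fun h => (s h)^T) @ 0^' --> xi^T.
  apply: cvg_mx => i j; rewrite mxE.
  rewrite (_ : (fun h => _) = fun h => s h j i); first exact: cvg_mx_coord.
  by apply/funext => h; rewrite mxE.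
have L : (fun h => (s h)^T *m U t + (U t)^T *m s h + h *: ((s h)^T *m s h)) @ 0^' -->
    xi^T *m U t + (U t)^T *m xi + (0 : R) *: (xi^T *m xi).
  apply: cvgD.
    by apply: cvgD; apply: cvg_mulmx => //; exact: cvg_cst.
  by apply: cvgZ; [exact: nbhs_dnbhs|exact: cvg_mulmx].
have Z : (fun h => (s h)^T *m U t + (U t)^T *m s h + h *: ((s h)^T *m s h)) @ 0^' -->
    (0 : 'M[R]_n.+1).
  apply: (near_cvg _ (cvg_cst (0 : 'M[R]_n.+1))); near=> h.
  have h0 : h != 0 by near: h; exact: nbhs_dnbhs_neq.
  have oh : orthogonal_group (U (h + t)).
    near: h; apply: nbhs_dnbhs; move: oU; rewrite (near_shift 0) => oU.
    by apply: filterS oU => h /=; rewrite subr0.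
  have E : U (h + t) = U t + h *: s h by rewrite /s scalerA mulfV // scale1r subrKC.
  have ET : (U t + h *: s h)^T = (U t)^T + h *: (s h)^T by rewrite raddfD/= linearZ.
  have e : h *: ((s h)^T *m U t + (U t)^T *m s h + h *: ((s h)^T *m s h)) = 0.
    apply: (@addrI _ 1%:M); rewrite addr0 -[RHS]oh E ET mulmxDl !mulmxDr oUt.
    rewrite -!scalemxAl -!scalemxAr -!addrA !scalerDr; congr (_ + _).
    by rewrite addrCA.
  by move/eqP: e; rewrite scaler_eq0 (negPf h0)/= => /eqP ->.
have := cvg_unique (@norm_hausdorff _ _) L Z.
rewrite scale0r addr0 => e; rewrite /Defs.skew/= trmx_mul trmxK.
by apply/eqP; rewrite -addr_eq0 e eqxx.
Unshelve. all: by end_near. Qed.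

Section PathLength.
Context {R : realType} {n : nat}.
Variable (f : 'rV[R]_n.+1 -> R).
Hypothesis f_lip : [lipschitz f mu | mu in cube].
Hypothesis f_eq0 : forall mu, cube mu -> (f mu = 0 <-> mu = 0).

Lemma cube0 : @cube R n 0.
Proof. by move=> i; rewrite mxE lexx ler01. Qed.

Lemma f0 : f 0 = 0.
Proof. by apply/(f_eq0 cube0). Qed.

Definition lifted_speed (mu : R -> 'rV[R]_n.+1) (U : R -> 'M[R]_n.+1) (t : R) : R :=
  Num.sqrt (\sum_i (derive1 mu t) 0 i ^+ 2 +
    \sum_(i < n.+1) \sum_(j < n.+1 | (i < j)%N)
      f (window (mu t) i j) ^+ 2 * (((U t)^T *m derive1 U t) i j) ^+ 2).

(** The velocity of W is the image of U A, where A = U^T U'.  Removing from A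
    its diagonal blocks, which are vertical, gives the horizontal lift; they
    do not contribute to the lifted speed either, their weights being f(0). *)
Lemma speed_lifted K mu W U (t : R) :
  (\forall u \near t, orthogonal_group (U u) /\ flag_proj (type_of K) (U u) = W u) ->
  open_simplex K (mu t) -> derivable U t 1 ->
  speed (metric f (K := K)) mu W t = lifted_speed mu U t.
Proof.
move=> UW muK dU; have [hU UWt] := nbhs_singleton UW.
have dU' : is_derive t 1 U (derive1 U t) by rewrite derive1E; exact: derivableP.
pose A := (U t)^T *m derive1 U t.
have sA : Defs.skew A.
  by apply: orthogonal_curve_skew dU'; apply: filterS UW => u [].
pose B : 'M[R]_n.+1 := \matrix_(i, j) if same_block (type_of K) i j then 0 else A i j.
have hB : horizontal_space (type_of K) B.
  split; last by move=> i j sij; rewrite mxE sij.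
  rewrite /Defs.skew/=; apply/matrixP => i j.
  rewrite 2![LHS]mxE [RHS]mxE [in RHS]mxE same_block_sym.
  by case: ifP => _; rewrite ?oppr0 // (skewE _ _ sA).
have pB : pushes (U t) (U t *m B) (velocity (I := type_of K) W t).
  apply: (pushes_mod_vertical (A := A)) => //; first by case: hB.
    by move=> i j nij; rewrite [RHS]mxE (negPf nij).
  rewrite /A orthogonal_mulVK //; apply: pushes_velocity => //.
  by apply: filterS UW => u [].
rewrite /speed /lifted_speed -UWt; congr Num.sqrt.
rewrite (metricE f (derive1 mu t) (derive1 mu t) muK hU hB hB pB pB) /metric_formula.
congr (_ + _); apply: eq_bigr => i _; apply: eq_bigr => j ij.
rewrite -mulrA -expr2 [B i j]mxE; case: ifP => // sij.
by rewrite (window_eq0 muK (ltnW ij)).2 // f0 expr0n !mul0r.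
Qed.

Lemma f_bound : exists2 k, 0 <= k & forall mu nu, cube mu -> cube nu ->
  `|f mu - f nu| <= k * `|mu - nu|.
Proof.
have [k [k0 Hk]] : exists k : R, 0 <= k /\
    forall p, (@cube R n `*` @cube R n) p -> `|f p.1 - f p.2| <= k * `|p.1 - p.2|.
  by near (pinfty_nbhs R) => k; exists k; split; near: k; [exact: nbhs_pinfty_ge|exact: f_lip].
by exists k => // mu nu cmu cnu; exact: (Hk (mu, nu)).
Unshelve. all: by end_near. Qed.

Section LiftedSpeed.
Variables (mu : R -> 'rV[R]_n.+1) (U : R -> 'M[R]_n.+1) (t : R).

Lemma lifted_speed_continuous : (\forall u \near t, cube (mu u)) ->
  derivable mu t 1 -> derivable U t 1 ->
  {for t, continuous (derive1 mu)} -> {for t, continuous (derive1 U)} ->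
  {for t, continuous (lifted_speed mu U)}.
Proof.
move=> cmu dmu dU cmu' cU'.
have mu_t : mu @ t --> mu t := derivable1_continuous_at dmu.
have U_t : U @ t --> U t := derivable1_continuous_at dU.
have mu'_t : derive1 mu @ t --> derive1 mu t := cmu'.
have U'_t : derive1 U @ t --> derive1 U t := cU'.
have [k k0 Hk] := f_bound.
have f_t i j : (fun u => f (window (mu u) i j)) @ t --> f (window (mu t) i j).
  have w_t : (fun u => window (mu u) i j) @ t --> window (mu t) i j.
    apply: cvg_mx => p q; rewrite mxE ord1.
    rewrite (_ : (fun u => _) = fun u => if (i <= q < j)%N then mu u 0 q else 0); last first.
      by apply/funext => u; rewrite mxE.
    by case: ifP => _; [exact: cvg_mx_coord|exact: cvg_cst].
  have d0 : (fun u => k * `|window (mu t) i j - window (mu u) i j|) @ t --> (0 : R).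
    rewrite -[X in _ --> X](mulr0 k) -(@normr0 _ 'rV[R]_n.+1) -(subrr (window (mu t) i j)).
    apply: cvgM; first exact: cvg_cst.
    by apply: cvg_norm; apply: cvgB => //; exact: cvg_cst.
  apply/cvgrPdist_lt => /= e e0; near=> u.
  apply: (@le_lt_trans _ _ (k * `|window (mu t) i j - window (mu u) i j|)).
    apply: Hk; apply: window_cube; first exact: nbhs_singleton cmu.
    by near: u.
  by rewrite -[ltLHS]ger0_norm ?mulr_ge0 //; near: u; apply: cvgr0_norm_lt.
apply: (@continuous_comp _ _ _ _ (@Num.sqrt R)); last exact: sqrt_continuous.
have sq (v : R -> R) (l : R) : v @ t --> l -> (fun u => v u ^+ 2) @ t --> l ^+ 2.
  move=> vl; rewrite expr2 (_ : (fun u => _) = v \* v); first exact: cvgM.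
  by apply/funext => u; rewrite /= expr2.
apply: cvgD.
  by apply: cvg_sum_seq => i _; apply: sq; exact: cvg_mx_coord.
apply: cvg_sum_seq => i _; apply: cvg_sum_seq => j _; apply: cvgM; first exact: sq.
apply: sq; apply: cvg_mx_coord; apply: cvg_mulmx => //.
apply: cvg_mx => p q; rewrite mxE.
rewrite (_ : (fun u => _) = fun u => U u q p); first exact: cvg_mx_coord.
by apply/funext => u; rewrite mxE.
Unshelve. all: by end_near. Qed.

End LiftedSpeed.

Lemma lifted_speed_bound (M : R) : exists C, forall mu U (t : R),
  cube (mu t) -> orthogonal_group (U t) ->
  `|derive1 mu t| <= M -> `|derive1 U t| <= M -> `|lifted_speed mu U t| <= C.
Proof.
have [k k0 Hk] := f_bound.
exists (Num.sqrt (\sum_(i < n.+1) M ^+ 2 + \sum_(i < n.+1) \sum_(j < n.+1 | (i < j)%N)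
   k ^+ 2 * (n.+1%:R * M) ^+ 2)) => mu U t cmu oU mu'M U'M.
have sqr_le (x y : R) : `|x| <= y -> x ^+ 2 <= y ^+ 2.
  by move=> xy; rewrite -[x ^+ 2]real_normK ?num_real // lerXn2r // nnegrE // (le_trans _ xy).
rewrite ger0_norm ?sqrtr_ge0 //; apply: ler_wsqrtr; apply: lerD.
  apply: ler_sum => i _; apply: sqr_le; apply: le_trans mu'M; exact: mx_entry_le_norm.
apply: ler_sum => i _; apply: ler_sum => j _; apply: ler_pM; rewrite ?sqr_ge0 //.
  apply: sqr_le; have cw : cube (window (mu t) i j) by exact: window_cube.
  rewrite -[f _]subr0 -f0; apply: le_trans (Hk _ _ cw cube0) _.
  rewrite subr0 -[leRHS]mulr1 ler_wpM2l //.
  rewrite /Num.Def.normr/= mx_normrE (bigmax_le _ ler01)//= => -[p q] _ /=.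
  by rewrite ord1; have /andP[w0 w1] := cw q; rewrite ger0_norm.
apply: sqr_le; rewrite mxE; apply: le_trans (ler_norm_sum _ _ _) _.
apply: (@le_trans _ _ (\sum_(l < n.+1) M)); last by rewrite sumr_const card_ord mulr_natl.
apply: ler_sum => l _; rewrite normrM mxE -[leRHS]mul1r ler_pM //.
  exact: orthogonal_entry_le1.
apply: le_trans U'M; exact: mx_entry_le_norm.
Qed.

End PathLength.

Lemma Rintegral_eq_off_finite (R : realType) (a b : R) (s : seq R) (phi psi : R -> R) :
  lebesgue_measure.-integrable `[a, b] (EFin \o phi) ->
  lebesgue_measure.-integrable `[a, b] (EFin \o psi) ->
  (forall t, t \in `]a, b[ -> t \notin s -> phi t = psi t) ->
  (\int[lebesgue_measure]_(t in `[a, b]) phi t)%R = (\int[lebesgue_measure]_(t in `[a, b]) psi t)%R.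
Proof.
move=> iphi ipsi e; rewrite /Rintegral; congr fine.
have mE := measurable_exceptional a b s.
have E0 := exceptional_measure0 a b s.
have L1 := negligible_integral (mu := @lebesgue_measure R) mE (measurable_itv `[a, b]) iphi E0.
have L2 := negligible_integral (mu := @lebesgue_measure R) mE (measurable_itv `[a, b]) ipsi E0.
rewrite [LHS]L1 [RHS]L2.
apply: eq_integral => t; rewrite inE => /off_exceptional[tI ts] /=.
by rewrite e.
Qed.

Section PathLengthFormula.
Context {R : realType} {n : nat}.
Variable (f : 'rV[R]_n.+1 -> R).
Hypothesis f_lip : [lipschitz f mu | mu in cube].
Hypothesis f_eq0 : forall mu, cube mu -> (f mu = 0 <-> mu = 0).

Lemma path_length_lifted (K : {set 'I_n.+1}) (a b : R) (mu : R -> 'rV[R]_n.+1)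
    (W : R -> set 'M[R]_n.+1) (U : R -> 'M[R]_n.+1) :
  piecewise_C1_in_cell K a b mu W ->
  piecewise (fun x y => Ck_on 1 `[x, y] U) a b ->
  (forall t, t \in `[a, b] ->
     orthogonal_group (U t) /\ flag_proj (type_of K) (U t) = W t) ->
  [/\ lebesgue_measure.-integrable `[a, b]
        (EFin \o speed (metric f (K := K)) mu W),
      lebesgue_measure.-integrable `[a, b] (EFin \o lifted_speed f mu U)
    & path_length (metric f (K := K)) a b mu W =
      \int[lebesgue_measure]_(t in `[a, b]) lifted_speed f mu U t].
Proof.
move=> [Hcell [p itvp Hp]] HU UW.
have [s1 [M1 H1]] : exists (s : seq R) (M : R), forall t, t \in `]a, b[ -> t \notin s ->
    [/\ derivable mu t 1, {for t, continuous (derive1 mu)} & `|derive1 mu t| <= M].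
  by apply: piecewise_C1_derive1; exists p => // i /Hp[].
have [s2 [M2 H2]] := piecewise_C1_derive1 HU.
pose s := s1 ++ s2.
have near_open (t : R) : t \in `]a, b[ -> \forall u \near t, u \in `]a, b[.
  by move=> tI; apply: open_nbhs_nbhs; split; [exact: interval_open|].
have near_good (t : R) : t \in `]a, b[ -> t \notin s ->
    \forall u \near t, (u \in `]a, b[) /\ u \notin s.
  move=> tI ts; have : regular_set a b s t by apply/off_exceptional.
  move=> rt; have := open_nbhs_nbhs (conj (@open_regular_set _ a b s) rt).
  by apply: filterS => u /off_exceptional.
have muK (t : R) : t \in `]a, b[ -> open_simplex K (mu t).
  by move=> /subset_itv_oo_cc tI; have [_] := Hcell t tI.
have cmu (t : R) : t \in `]a, b[ -> cube (mu t) by move=> /muK[[]].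
have UW' (t : R) : t \in `]a, b[ -> \forall u \near t,
    orthogonal_group (U u) /\ flag_proj (type_of K) (U u) = W u.
  by move=> /near_open; apply: filterS => u /subset_itv_oo_cc; exact: UW.
have reg (t : R) : t \in `]a, b[ -> t \notin s ->
  [/\ derivable mu t 1, derivable U t 1, {for t, continuous (lifted_speed f mu U)} &
      speed (metric f (K := K)) mu W t = lifted_speed f mu U t].
  move=> tI; rewrite mem_cat negb_or => /andP[ts1 ts2].
  have [dmu cmu' _] := H1 t tI ts1; have [dU cU' _] := H2 t tI ts2.
  split => //; last by apply: speed_lifted => //; [exact: UW'|exact: muK].
  apply: lifted_speed_continuous => //.
  by apply: filterS (near_open t tI) => u /cmu.
have [C HC] := lifted_speed_bound f_lip f_eq0 (Num.max M1 M2).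
have bound (t : R) : t \in `]a, b[ -> t \notin s -> `|lifted_speed f mu U t| <= C.
  move=> tI; rewrite mem_cat negb_or => /andP[ts1 ts2].
  have [_ _ b1] := H1 t tI ts1; have [_ _ b2] := H2 t tI ts2.
  apply: HC; first exact: cmu.
  - by have [] := UW t (subset_itv_oo_cc tI).
  - by rewrite le_max b1.
  - by rewrite le_max b2 orbT.
have iL : lebesgue_measure.-integrable `[a, b] (EFin \o lifted_speed f mu U).
  by apply: (@integrable_off_exceptional _ a b C s) => // t tI ts; have [] := reg t tI ts.
have iS : lebesgue_measure.-integrable `[a, b] (EFin \o speed (metric f (K := K)) mu W).
  apply: (@integrable_off_exceptional _ a b C s) => t tI ts.
    have [_ _ cL _] := reg t tI ts; apply: near_eq_continuous_at cL.
    by apply: filterS (near_good t tI ts) => u [uI us]; have [_ _ _ ->] := reg u uI us.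
  by have [_ _ _ ->] := reg t tI ts; exact: bound.
split => //; apply: (Rintegral_eq_off_finite (s := s)) => // t tI ts.
by have [_ _ _ ->] := reg t tI ts.
Qed.

End PathLengthFormula.

Theorem proposition4p2 (R : realType) (n : nat) (f : 'rV[R]_n.+1 -> R)
    (f_ge0 : forall mu, cube mu -> 0 <= f mu)
    (f_lip : [lipschitz f mu | mu in cube])
    (f_C2 : Ck_on 2 (cube `\ 0) f)
    (f_eq0 : forall mu, cube mu -> (f mu = 0 <-> mu = 0)) :
  [/\ (* (i) *)
      forall (K : {set 'I_n.+1}) (mu : 'rV[R]_n.+1) (W : set 'M[R]_n.+1)
        (alpha beta : 'rV[R]_n.+1) (X Y : smooth_fun R n (type_of K) -> R),
        cell K (mu, W) ->
        cell_tangent (mu, W) ((alpha, X) : tvec R n K) ->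
        cell_tangent (mu, W) ((beta, Y) : tvec R n K) ->
        forall U : 'M[R]_n.+1, orthogonal_group U -> flag_proj (type_of K) U = W ->
          exists Xt Yt : 'M[R]_n.+1,
            [/\ unique (horizontal_lift U X) Xt,
                unique (horizontal_lift U Y) Yt
              & metric f (mu, W) ((alpha, X) : tvec R n K) (beta, Y) =
                metric_formula f mu alpha beta (U^T *m Xt) (U^T *m Yt)],
      (* (ii) *)
      forall K : {set 'I_n.+1}, K != finset.set0 ->
        riemannian_metric 2 (metric f (K := K))
    & (* (iii) *)
      forall (K : {set 'I_n.+1}) (a b : R) (mu : R -> 'rV[R]_n.+1)
        (W : R -> set 'M[R]_n.+1) (U : R -> 'M[R]_n.+1),
        K != finset.set0 -> a <= b ->
        piecewise_C1_in_cell K a b mu W ->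
        piecewise (fun x y => Ck_on 1 `[x, y] U) a b ->
        (forall t, t \in `[a, b] ->
           orthogonal_group (U t) /\ flag_proj (type_of K) (U t) = W t) ->
        let lifted_speed t :=
          Num.sqrt (\sum_i (derive1 mu t) 0 i ^+ 2 +
            \sum_(i < n.+1) \sum_(j < n.+1 | (i < j)%N)
              f (window (mu t) i j) ^+ 2 * (((U t)^T *m derive1 U t) i j) ^+ 2) in
        [/\ lebesgue_measure.-integrable `[a, b]
              (EFin \o speed (metric f (K := K)) mu W),
            lebesgue_measure.-integrable `[a, b] (EFin \o lifted_speed)
          & path_length (metric f (K := K)) a b mu W =
            \int[lebesgue_measure]_(t in `[a, b]) lifted_speed t]].

Proof.
split.
- move=> K mu W alpha beta X Y; exact: metric_well_defined.
- by move=> K _; exact: metric_riemannian.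
- move=> K a b mu W U _ _ muW pU UW; exact: path_length_lifted.
Qed.
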